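(* The following two assertions are equivalent. (A) For every $n\ge1$ and every homogeneous polynomial $P(z)\in\mathbb{C}[z]=\mathbb{C}[z_1,\dots,z_n]$ of degree $d=4$ whose Hessian matrix $\left(\frac{\partial^2P}{\partial z_i\partial z_j}\right)$ is nilpotent, the unique power series solution $U_t(z)\in\mathbb{C}[[z,t]]$ of the Cauchy problem $$\frac{\partial U_t}{\partial t}(z)=\frac12\langle\nabla U_t(z),\nabla U_t(z)\rangle,\qquad U_{t=0}(z)=P(z)$$ is a polynomial in both $z$ and $t$. (B) (Jacobian conjecture) For every $n\ge1$ and every polynomial map $F(z)=z-H(z)$ from $\mathbb{C}^n$ to $\mathbb{C}^n$ with $o(H(z))\ge1$ whose Jacobian satisfies $j(F)(z)=1$, the formal inverse map $G(z)$ of $F(z)$ is also a polynomial map.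
   Context: $\nabla$ is the gradient with respect to $z$; $\langle a,b\rangle=\sum_i a_ib_i$. $j(F)$ is the determinant of the Jacobian matrix of $F$. $o(H)\ge1$ means every component of $H$ has zero constant term. The formal inverse of $F$ is the $G\in\mathbb{C}[[z]]^n$ with $F(G(z))=z=G(F(z))$. *)

(* Defs.v *)
From HB Require Import structures.
From mathcomp Require Import all_boot all_order all_algebra.
From mathcomp Require Import boolp reals complex mpoly.

Set Implicit Arguments.
Unset Strict Implicit.
Unset Printing Implicit Defensive.

Import GRing.Theory.
Local Open Scope ring_scope.

(** [mseries n R] is R[[z_1, ..., z_n]], a series being given by its
    coefficients, which are indexed by the multi-exponents ['X_{1..n}] of the
    multinomials library. *)

Record mseries (n : nat) (R : Type) := MSeries { scoef :> 'X_{1..n} -> R }.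

Lemma mseriesP n R (u v : mseries n R) : (forall m, u m = v m) -> u = v.
Proof. by case: u v => u [v] /= uv; congr MSeries; apply: funext. Qed.

HB.instance Definition _ n R := gen_eqMixin (mseries n R).
HB.instance Definition _ n R := gen_choiceMixin (mseries n R).

Section SeriesModule.
Variables (n : nat) (R : nzRingType).
Implicit Types u v w : mseries n R.

Definition ms0 : mseries n R := MSeries (fun=> 0).
Definition msopp u : mseries n R := MSeries (fun m => - u m).
Definition msadd u v : mseries n R := MSeries (fun m => u m + v m).
Definition msscale (c : R) u : mseries n R := MSeries (fun m => c * u m).

Fact msaddA : associative msadd.
Proof. by move=> u v w; apply: mseriesP => m /=; rewrite addrA. Qed.
Fact msaddC : commutative msadd.
Proof. by move=> u v; apply: mseriesP => m /=; rewrite addrC. Qed.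
Fact msadd0 : left_id ms0 msadd.
Proof. by move=> u; apply: mseriesP => m /=; rewrite add0r. Qed.
Fact msaddN : left_inverse ms0 msopp msadd.
Proof. by move=> u; apply: mseriesP => m /=; rewrite addNr. Qed.

HB.instance Definition _ :=
  GRing.isZmodule.Build (mseries n R) msaddA msaddC msadd0 msaddN.

Fact msscaleA a b u : msscale a (msscale b u) = msscale (a * b) u.
Proof. by apply: mseriesP => m /=; rewrite mulrA. Qed.
Fact msscale1 : left_id 1 msscale.
Proof. by move=> u; apply: mseriesP => m /=; rewrite mul1r. Qed.
Fact msscaleDr : right_distributive msscale +%R.
Proof. by move=> a u v; apply: mseriesP => m /=; rewrite mulrDr. Qed.
Fact msscaleDl u : {morph msscale^~ u : a b / a + b}.
Proof. by move=> a b; apply: mseriesP => m /=; rewrite mulrDl. Qed.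

HB.instance Definition _ :=
  GRing.Zmodule_isLmodule.Build R (mseries n R)
    msscaleA msscale1 msscaleDr msscaleDl.

Definition series_of_mpoly (p : {mpoly R[n]}) : mseries n R :=
  MSeries (fun m => p@_m).

Definition is_polynomial u : Prop :=
  exists p : {mpoly R[n]}, u = series_of_mpoly p.

(** Cauchy product; same shape as [mcoeffM] for polynomials. *)
Definition msmul u v : mseries n R := MSeries (fun m =>
  \sum_(k : 'X_{1..n < (mdeg m).+1, (mdeg m).+1} | m == (k.1 + k.2)%MM)
     u k.1 * v k.2).

Definition ms1 : mseries n R := series_of_mpoly 1.

End SeriesModule.

Section SeriesRing.
Variables (n : nat) (R : comNzRingType).
Implicit Types (u v w : mseries n R) (p q : {mpoly R[n]}).

Definition eq_upto d u p : Prop :=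
  forall k, (mdeg k <= d)%N -> u k = p@_k.

Definition mstrunc d u : {mpoly R[n]} :=
  \sum_(k : 'X_{1..n < d.+1}) u k *: 'X_[k].

Lemma mstruncP d u : eq_upto d u (mstrunc d u).
Proof. by move=> k kd; rewrite /mstrunc mcoeff_mpoly. Qed.

Lemma eq_upto_mul d u v p q :
  eq_upto d u p -> eq_upto d v q -> eq_upto d (msmul u v) (p * q).
Proof.
move=> up vq m md /=; rewrite mcoeffM; apply: eq_bigr => -[k l] /= _.
by rewrite up ?vq // (leq_trans _ md) // -ltnS bmdeg.
Qed.

Lemma eq_upto_eq u v :
  (forall d, exists2 p, eq_upto d u p & eq_upto d v p) -> u = v.
Proof.
move=> uv; apply: mseriesP => m.
by have [q uq vq] := uv (mdeg m); rewrite uq ?vq.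
Qed.

Fact msmulA : associative (@msmul n R).
Proof.
move=> u v w; apply: eq_upto_eq => d.
exists (mstrunc d u * (mstrunc d v * mstrunc d w)); last rewrite mulrA;
  by do 2?[apply: eq_upto_mul]; apply: mstruncP.
Qed.

Fact msmulC : commutative (@msmul n R).
Proof.
move=> u v; apply: eq_upto_eq => d.
exists (mstrunc d u * mstrunc d v); last rewrite mulrC;
  by apply: eq_upto_mul; apply: mstruncP.
Qed.

Fact msmul1 : left_id (ms1 n R) (@msmul n R).
Proof.
move=> u; apply: eq_upto_eq => d.
exists (1 * mstrunc d u); last by rewrite mul1r; apply: mstruncP.
by apply: eq_upto_mul; [|apply: mstruncP].
Qed.

Fact msmulDl : left_distributive (@msmul n R) +%R.
Proof.
move=> u v w; apply: mseriesP => m /=; rewrite -big_split /=.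
by apply: eq_bigr => k _; rewrite mulrDl.
Qed.

Fact ms1_neq0 : ms1 n R != 0.
Proof.
apply/eqP => /(congr1 (fun u : mseries n R => u 0%MM)) /=.
by rewrite mcoeff1 eqxx => /eqP; rewrite oner_eq0.
Qed.

HB.instance Definition _ :=
  GRing.Zmodule_isComNzRing.Build (mseries n R)
    msmulA msmulC msmul1 msmulDl ms1_neq0.

End SeriesRing.

(** Formal partial derivative; same shape as [mcoeff_deriv]. *)
Definition msderiv n (R : nzRingType) (i : 'I_n) (u : mseries n R) :
    mseries n R :=
  MSeries (fun m => u (m + U_(i))%MM *+ (m i).+1).

(** [mscomp u v] is u(v_1(z), ..., v_k(z)) for v_1, ..., v_k without constant
    term: the product [\prod_i v i ^+ l i] then has order at least [mdeg l], so
    that only the exponents [l] of degree at most [mdeg m] contribute to the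
    coefficient of z^m. *)
Definition mscomp k n (R : comNzRingType)
    (u : mseries k R) (v : 'I_k -> mseries n R) : mseries n R :=
  MSeries (fun m =>
    \sum_(l : 'X_{1..k < (mdeg m).+1}) u l * (\prod_(i < k) v i ^+ l i) m).

(** For a polynomial map [F] without constant term, [G(F(z)) = z] forces every
    [G i] to have zero constant term, so both compositions are meaningful. *)
Definition is_formal_inverse n (R : comNzRingType)
    (F : 'I_n -> {mpoly R[n]}) (G : 'I_n -> mseries n R) : Prop :=
  (forall i, mscomp (series_of_mpoly (F i)) G = series_of_mpoly 'X_i) /\
  (forall i, mscomp (G i) (fun j => series_of_mpoly (F j))
             = series_of_mpoly 'X_i).

Definition jacobian n (R : nzRingType) (F : 'I_n -> {mpoly R[n]}) :
    'M[{mpoly R[n]}]_n :=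
  \matrix_(i, j) (F i)^`M(j).

Definition hessian n (R : nzRingType) (P : {mpoly R[n]}) :
    'M[{mpoly R[n]}]_n :=
  \matrix_(i, j) (P^`M(j))^`M(i).

Definition nilpotent_mx n (R : nzRingType) (A : 'M[R]_n) : Prop :=
  exists k : nat, A ^+ k = 0.

(** A series in C[[z, t]] has [n.+1] variables: z_i is the variable number
    [widen_ord (leqnSn n) i] and t is the variable number [ord_max]. *)

Definition deriv_t n (R : nzRingType) (U : mseries n.+1 R) : mseries n.+1 R :=
  msderiv ord_max U.

Definition grad_z n (R : nzRingType) (U : mseries n.+1 R) (i : 'I_n) :
    mseries n.+1 R :=
  msderiv (widen_ord (leqnSn n) i) U.

Definition dot n (S : nzRingType) (a b : 'I_n -> S) : S :=
  \sum_(i < n) a i * b i.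

(** The value at t = 0; [mnmwiden m] extends [m] by the exponent 0 of t. *)
Definition at_t0 n (R : Type) (U : mseries n.+1 R) : mseries n R :=
  MSeries (fun m => U (mnmwiden m)).

Definition cauchy_solution n (K : fieldType)
    (P : {mpoly K[n]}) (U : mseries n.+1 K) : Prop :=
  deriv_t U = 2^-1 *: dot (grad_z U) (grad_z U) /\
  at_t0 U = series_of_mpoly P.

(* Main.v *)
Require Import Defs.
From HB Require Import structures.
From mathcomp Require Import all_boot all_order all_algebra.
From mathcomp Require Import boolp reals complex mpoly.
From mathcomp Require Import ring zify.

(** (B => A): for P with nilpotent Hessian, F = (z - t grad P, t) has Jacobian
    determinant 1, so its inverse (z + t N, t) is polynomial, and the Hopf-Lax
    formula P(z + t N) - t/2 <N, N> is a polynomial solution of the Cauchy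
    problem.

    (A => B): a polynomial solution U gives the polynomial inverse
    z + grad U_{t=1} of z - grad P. It remains to reduce the Jacobian conjecture
    to the maps z - grad P. The degree is lowered to 3 by conjugating F x id with
    elementary automorphisms that replace a product pq by (u + p)(v + q) (Bass,
    Connell, Wright); a further pair of elementary automorphisms makes
    z - t H_2 - t^2 H_3 cubic homogeneous; and z - H(z) is embedded in z - grad P
    with P = sum_j w_j H_j(zeta), zeta = x + iy, w = (x - iy)/2 (de Bondt, van
    den Essen). *)

Set Implicit Arguments.
Unset Strict Implicit.
Unset Printing Implicit Defensive.

Import GRing.Theory.
Local Open Scope ring_scope.

(** * Substitution in polynomials and the chain rule *)

Section PolynomialSubstitution.
Variables (K : comNzRingType).

Lemma mpoly_rmorph_ext n (S : comNzRingType)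
    (f g : {rmorphism {mpoly K[n]} -> S}) :
  (forall c, f c%:MP = g c%:MP) -> (forall i, f 'X_i = g 'X_i) -> f =1 g.
Proof.
move=> fgC fgX; elim/mpolyind => [|c m p _ _ IH]; first by rewrite !rmorph0.
rewrite !rmorphD /= IH -mul_mpolyC !rmorphM fgC mpolyXE_id !rmorph_prod.
by congr (_ * _ + _); apply: eq_bigr => i _; rewrite !rmorphXn /= fgX.
Qed.

Lemma rmorph_mmap n (S T : comNzRingType) (phi : {rmorphism S -> T})
    (f : {rmorphism K -> S}) (h : 'I_n -> S) p :
  phi (mmap f h p) = mmap (phi \o f) (phi \o h) p.
Proof.
pose a : {rmorphism _ -> _} := phi \o mmap f h.
pose b : {rmorphism _ -> _} := mmap (phi \o f) (phi \o h).
apply: (@mpoly_rmorph_ext n T a b) => [c|i] /=; first by rewrite !mmapC.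
by rewrite !mmapX !mmap1U.
Qed.

Lemma mderivXX n (i j : 'I_n) : ('X_i : {mpoly K[n]})^`M(j) = (i == j)%:R.
Proof.
rewrite mderivX mnm1E; case: eqVneq => [->|_]; last by rewrite scale0r.
rewrite scale1r (_ : (U_(j) - U_(j))%MM = 0%MM) ?mpolyX0 //.
by apply/mnmP => k; rewrite !mnmE subnn.
Qed.

(** Both sides are additive in [p], and by the Leibniz rule the identity passes to products, so
    constants and variables suffice. *)
Lemma mmap_chain n (S : comNzRingType) (f : {rmorphism K -> S})
    (h : 'I_n -> S) (D : S -> S) p :
  {morph D : x y / x + y} -> (forall x y, D (x * y) = D x * y + x * D y) ->
  (forall c, D (f c) = 0) ->
  D (mmap f h p) = \sum_j mmap f h p^`M(j) * D (h j).
Proof.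
move=> DD DM Df.
have D0 : D 0 = 0 by have := Df 0; rewrite rmorph0.
pose Q q := D (mmap f h q) = \sum_j mmap f h q^`M(j) * D (h j).
have QM q r : Q q -> Q r -> Q (q * r).
  rewrite /Q => Qq Qr; rewrite rmorphM DM Qq Qr mulr_suml mulr_sumr -big_split.
  apply: eq_bigr => j _; rewrite mderivM raddfD /= !rmorphM /=; ring.
have QX i : Q 'X_i.
  rewrite /Q mmapX mmap1U (bigD1 i) //= big1 ?addr0 => [|j ji].
    by rewrite mderivXX eqxx rmorph1 mul1r.
  by rewrite mderivXX eq_sym (negPf ji) raddf0 mul0r.
have QC c : Q c%:MP.
  rewrite /Q mmapC Df big1 // => j _.
  by rewrite mderivC raddf0 mul0r.
rewrite -/(Q p); elim/mpolyind: p => [|c m p _ _ Qp].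
  by rewrite /Q raddf0 D0 big1 // => j _; rewrite mderiv0 raddf0 mul0r.
rewrite /Q raddfD /= DD Qp; suff -> : Q (c *: 'X_[m]).
  by rewrite -big_split; apply: eq_bigr => j _ /=; rewrite mderivD raddfD mulrDl.
rewrite -mul_mpolyC; apply: (QM) => //; rewrite mpolyXE_id.
apply: (big_ind Q) => [|a b|i _]; [exact: QC|exact: QM|].
by elim: (m i) => [|e IH]; [exact: QC|rewrite exprS; apply: (QM)].
Qed.

Definition msubst n k (v : 'I_n -> {mpoly K[k]}) : {mpoly K[n]} -> {mpoly K[k]} :=
  mmap (@mpolyC k K) v.

HB.instance Definition _ n k (v : 'I_n -> {mpoly K[k]}) :=
  GRing.RMorphism.copy (msubst v) (mmap (@mpolyC k K) v).

Lemma msubstC n k (v : 'I_n -> {mpoly K[k]}) c : msubst v c%:MP = c%:MP.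
Proof. by rewrite /msubst mmapC. Qed.

Lemma msubstX n k (v : 'I_n -> {mpoly K[k]}) i : msubst v 'X_i = v i.
Proof. by rewrite /msubst mmapX mmap1U. Qed.

Lemma msubstZ n k (v : 'I_n -> {mpoly K[k]}) c p :
  msubst v (c *: p) = c *: msubst v p.
Proof. by rewrite -!mul_mpolyC rmorphM /= msubstC. Qed.

Lemma msubst_ext n k (v w : 'I_n -> {mpoly K[k]}) :
  v =1 w -> msubst v =1 msubst w.
Proof.
by move=> vw; apply: mpoly_rmorph_ext => [c|i] /=; rewrite ?msubstC ?msubstX.
Qed.

Lemma msubst_comp n k l (v : 'I_n -> {mpoly K[k]}) (w : 'I_k -> {mpoly K[l]}) p :
  msubst w (msubst v p) = msubst (fun i => msubst w (v i)) p.
Proof.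
apply: (@mpoly_rmorph_ext n _ (msubst w \o msubst v)) => [c|i] /=.
  by rewrite !msubstC.
by rewrite !msubstX.
Qed.

Lemma msubst_id n p : msubst (fun i : 'I_n => 'X_i) p = p.
Proof.
apply: (@mpoly_rmorph_ext n _ (msubst _) idfun) => [c|i] /=.
  by rewrite msubstC.
by rewrite msubstX.
Qed.

Lemma mderiv_msubst n k (v : 'I_n -> {mpoly K[k]}) i p :
  (msubst v p)^`M(i) = \sum_j msubst v p^`M(j) * (v j)^`M(i).
Proof.
apply: (@mmap_chain n _ _ v (mderiv i)) => [x y|x y|c]; first exact: mderivD.
  exact: mderivM.
exact: mderivC.
Qed.

Lemma jacobian_msubst n k l (F : 'I_n -> {mpoly K[k]}) (G : 'I_k -> {mpoly K[l]}) :
  \matrix_(i < n, j < l) (msubst G (F i))^`M(j)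
  = (\matrix_(i < n, j < k) msubst G (F i)^`M(j))
    *m (\matrix_(i < k, j < l) (G i)^`M(j)).
Proof.
apply/matrixP => i j; rewrite !mxE mderiv_msubst.
by apply: eq_bigr => s _; rewrite !mxE.
Qed.

Lemma mmap_homog n (S : comNzRingType) (f : {rmorphism K -> S}) d
    (p : {mpoly K[n]}) (v : 'I_n -> S) s :
  p \is d.-homog -> mmap f (fun i => s * v i) p = s ^+ d * mmap f v p.
Proof.
move=> /dhomogP hp; rewrite (mpolyE p) !raddf_sum mulr_sumr /=.
rewrite !big_seq; apply: eq_bigr => m /hp hm.
rewrite !mmapZ mulrCA; congr (_ * _).
rewrite !mmapX /mmap1 -hm /= mdegE -prodrXr -big_split /=.
by apply: eq_bigr => i _; rewrite exprMn.
Qed.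

Lemma msubst_homog n k d (p : {mpoly K[n]}) (v : 'I_n -> {mpoly K[k]}) s :
  p \is d.-homog -> msubst (fun i => s * v i) p = s ^+ d * msubst v p.
Proof. exact: mmap_homog. Qed.

Lemma msubst_linear_homog n k d (p : {mpoly K[n]}) (v : 'I_n -> {mpoly K[k]}) :
  (forall i, v i \is 1.-homog) -> p \is d.-homog -> msubst v p \is d.-homog.
Proof.
move=> v1 /dhomogP ph; rewrite (mpolyE p) rmorph_sum big_seq; apply: rpred_sum => m.
move=> /ph /= <-; rewrite msubstZ rpredZ // /msubst mmapX /mmap1 mdegE.
elim/big_ind2: _ => [|q i r j|i _]; [exact: dhomog1|exact: dhomogM|].
by have := dhomogMn (m i) (v1 i); rewrite mul1n.
Qed.

Lemma mderiv_homog n d (p : {mpoly K[n]}) i :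
  p \is d.+1.-homog -> p^`M(i) \is d.-homog.
Proof.
move=> /dhomogP hp; apply/dhomogP => m; rewrite mcoeff_msupp mcoeff_deriv => nz.
have /hp : (m + U_(i))%MM \in msupp p.
  by rewrite mcoeff_msupp; apply: contraNneq nz => ->; rewrite mul0rn.
by rewrite /= mdegD mdeg1 addn1 => -[].
Qed.

End PolynomialSubstitution.

(** * Polynomials inside the series ring, and their evaluation at series *)

Section SeriesFacts.
Variables (n : nat) (K : comNzRingType).
Implicit Types (u v : mseries n K) (p : {mpoly K[n]}).

Fact series_of_mpoly_is_zmod_morphism : zmod_morphism (@series_of_mpoly n K).
Proof. by move=> p q; apply: mseriesP => m /=; rewrite mcoeffB. Qed.

HB.instance Definition _ := GRing.isZmodMorphism.Build {mpoly K[n]} (mseries n K)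
  (@series_of_mpoly n K) series_of_mpoly_is_zmod_morphism.

Fact series_of_mpoly_is_monoid_morphism : monoid_morphism (@series_of_mpoly n K).
Proof. by split=> // p q; apply: mseriesP => m /=; rewrite mcoeffM. Qed.

HB.instance Definition _ := GRing.isMonoidMorphism.Build {mpoly K[n]}
  (mseries n K) (@series_of_mpoly n K) series_of_mpoly_is_monoid_morphism.

Lemma series_of_mpoly_inj : injective (@series_of_mpoly n K).
Proof.
by move=> p q pq; apply/mpolyP => m; apply: (congr1 (fun u : mseries n K => u m) pq).
Qed.

Lemma series_of_mpolyZ c p : series_of_mpoly (c *: p) = c *: series_of_mpoly p.
Proof. by apply: mseriesP => m /=; rewrite mcoeffZ. Qed.

Lemma msderiv_poly i p : msderiv i (series_of_mpoly p) = series_of_mpoly p^`M(i).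
Proof. by apply: mseriesP => m /=; rewrite mcoeff_deriv. Qed.

Lemma scoef_sum (I : Type) (r : seq I) (P : pred I) (f : I -> mseries n K) m :
  (\sum_(i <- r | P i) f i) m = \sum_(i <- r | P i) f i m.
Proof. by apply: (big_morph (fun u : mseries n K => u m)). Qed.

Lemma scoefCM c u m : (series_of_mpoly c%:MP * u) m = c * u m.
Proof.
have E : eq_upto (mdeg m) (series_of_mpoly c%:MP * u) (c%:MP * mstrunc (mdeg m) u).
  by apply: eq_upto_mul => //; apply: mstruncP.
by rewrite E // mcoeffCM -(mstruncP u).
Qed.

Lemma msscaleE c u : c *: u = series_of_mpoly c%:MP * u.
Proof. by apply: mseriesP => m; rewrite scoefCM. Qed.

Definition order_ge d u := forall m, (mdeg m < d)%N -> u m = 0.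

Lemma order_geM d e u v : order_ge d u -> order_ge e v -> order_ge (d + e) (u * v).
Proof.
move=> hu hv m hm; apply: big1 => -[[k _] [l _]] /= /eqP mE.
have [kd|dk] := ltnP (mdeg k) d; first by rewrite hu // mul0r.
by rewrite hv ?mulr0 //; move: hm; rewrite mE mdegD; lia.
Qed.

Lemma order_ge_mmap1 k (v : 'I_k -> mseries n K) l :
  (forall i, v i 0%MM = 0) -> order_ge (mdeg l) (mmap1 v l).
Proof.
move=> v0; rewrite mdegE /mmap1.
elim/big_ind2: _ => [m|d u e w|i _]; [by []|exact: order_geM|].
elim: (l i) => [m|e IH]; [by []|rewrite exprS; apply: (@order_geM 1) => //].
by move=> m; rewrite ltnS leqn0 mdeg_eq0 => /eqP ->.
Qed.

End SeriesFacts.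

(** A ring morphism by construction, unlike [mscomp], with which it agrees on polynomials when [v]
    has no constant term. *)
Definition seval k n (K : comNzRingType) (v : 'I_k -> mseries n K)
    (p : {mpoly K[k]}) : mseries n K :=
  mmap (@series_of_mpoly n K \o @mpolyC n K) v p.

HB.instance Definition _ k n (K : comNzRingType) (v : 'I_k -> mseries n K) :=
  GRing.RMorphism.copy (seval v) (mmap (@series_of_mpoly n K \o @mpolyC n K) v).

(** The truncation in [mscomp] loses nothing: without constant terms in [v], the product with
    exponent [l] has order at least [mdeg l], so it cannot reach a coefficient [m] of smaller
    degree. *)
Lemma mscomp_poly k n (K : comNzRingType) (v : 'I_k -> mseries n K) p :
  (forall i, v i 0%MM = 0) -> mscomp (series_of_mpoly p) v = seval v p.
Proof.
move=> v0; apply: mseriesP => m.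
elim/mpolyind: p => [|c l p _ _ IH].
  by rewrite (rmorph0 (seval v)) /= big1 // => l _; rewrite mcoeff0 mul0r.
have sE : seval v (c *: 'X_[l]) = series_of_mpoly c%:MP * mmap1 v l.
  by rewrite /seval mmapZ mmapX.
rewrite (rmorphD (seval v)) /= sE scoefCM -IH /=.
rewrite -[in RHS](_ : \sum_(a : 'X_{1..k < (mdeg m).+1})
    (c * (l == a)%:R) * (\prod_(i < k) v i ^+ a i) m = c * mmap1 v l m).
  by rewrite -big_split; apply: eq_bigr => a _; rewrite mcoeffD mcoeffZ mcoeffX mulrDl.
have [lm|ml] := leqP (mdeg l) (mdeg m).
  have lm' : (mdeg l < (mdeg m).+1)%N by [].
  rewrite (bigD1 (BMultinom lm')) //= eqxx mulr1 [X in _ + X]big1 ?addr0 // => a ne.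
  rewrite (_ : (l == a) = false) ?mulr0 ?mul0r //; apply/eqP => la.
  by case/eqP: ne; apply: val_inj.
rewrite (order_ge_mmap1 v0 ml) mulr0; apply: big1 => a _.
rewrite (_ : (l == a) = false) ?mulr0 ?mul0r //; apply/eqP => la.
by have := bmdeg a; rewrite -la ltnS leqNgt ml.
Qed.

Lemma seval_poly k n (K : comNzRingType) (v : 'I_k -> {mpoly K[n]}) p :
  seval (fun i => series_of_mpoly (v i)) p = series_of_mpoly (msubst v p).
Proof. by rewrite /msubst rmorph_mmap. Qed.

Lemma seval_msubst k l n (K : comNzRingType) (v : 'I_l -> mseries n K)
    (w : 'I_k -> {mpoly K[l]}) p :
  seval v (msubst w p) = seval (fun i => seval v (w i)) p.
Proof.
pose phi : {rmorphism {mpoly K[l]} -> mseries n K} :=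
  mmap (@series_of_mpoly n K \o @mpolyC n K) v.
rewrite -[LHS]/(phi _) /msubst rmorph_mmap /seval.
by congr mmap; apply: funext => c /=; rewrite mmapC.
Qed.

Lemma seval_ext k n (K : comNzRingType) (v w : 'I_k -> mseries n K) p :
  v =1 w -> seval v p = seval w p.
Proof. by move=> /funext ->. Qed.

Lemma sevalX n (K : comNzRingType) (p : {mpoly K[n]}) :
  seval (fun i => series_of_mpoly 'X_i) p = series_of_mpoly p.
Proof. by rewrite seval_poly msubst_id. Qed.

(** * Constant terms and uniqueness of the formal inverse *)

Lemma mcoeff0_msubst k n (K : comNzRingType) (v : 'I_k -> {mpoly K[n]}) p :
  (forall i, (v i)@_0%MM = 0) -> (msubst v p)@_0%MM = p@_0%MM.
Proof.
move=> v0; pose c0 m : {rmorphism {mpoly K[m]} -> K} := mcoeff 0%MM.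
apply: (@mpoly_rmorph_ext K k K (c0 n \o msubst v) (c0 k)) => [c|i] /=.
  by rewrite msubstC /c0 /= !mcoeffC !eqxx.
by rewrite msubstX /c0 /= v0 mcoeffX mnm1_eq0.
Qed.

(** At the exponent 0 the truncated sum in [mscomp] keeps only [l = 0], so the constant coefficient
    of G_i(F) is that of G_i. *)
Lemma formal_inverse_coef0 n (K : comNzRingType) (F : 'I_n -> {mpoly K[n]})
    (G : 'I_n -> mseries n K) :
  (forall i, mscomp (G i) (fun j => series_of_mpoly (F j)) = series_of_mpoly 'X_i) ->
  forall i, G i 0%MM = 0.
Proof.
move=> GF i.
have := congr1 (fun u : mseries n K => u 0%MM) (GF i).
rewrite /= mcoeffX mnm1_eq0 => E; rewrite -[RHS]E.
have h : (mdeg (0 : 'X_{1..n})%MM < (mdeg (0 : 'X_{1..n})%MM).+1)%N by [].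
rewrite (bigD1 (BMultinom h)) //= [X in _ + X]big1 ?addr0 => [|a ne].
  rewrite [in RHS]big1 => [|j _]; last by rewrite mnm0E expr0.
  by rewrite [X in _ * X]mcoeff1 eqxx mulr1.
case/eqP: ne; apply: val_inj => /=; apply/eqP.
rewrite -mdeg_eq0 -leqn0; apply: leq_trans (eq_leq (@mdeg0 n)).
by rewrite -ltnS bmdeg.
Qed.

(** If G' is another formal inverse, then G = G(F(G')) = G'. *)
Lemma formal_inverse_unique n (K : comNzRingType) (F G : 'I_n -> {mpoly K[n]}) :
  (forall i, (F i)@_0%MM = 0) -> (forall i, msubst G (F i) = 'X_i) ->
  (forall i, msubst F (G i) = 'X_i) ->
  unique (is_formal_inverse F) (fun i => series_of_mpoly (G i)).
Proof.
move=> F0 FG GF.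
have G0 i : (G i)@_0%MM = 0.
  by rewrite -(mcoeff0_msubst (G i) F0) GF mcoeffX mnm1_eq0.
split=> [|G' [FG' G'F]].
  by split=> i; rewrite mscomp_poly ?seval_poly ?FG ?GF.
have G'0 := formal_inverse_coef0 G'F.
apply: funext => i; rewrite -sevalX.
under seval_ext => j do rewrite -(FG' j) mscomp_poly //.
by rewrite -seval_msubst GF /seval mmapX mmap1U.
Qed.

(** * Uniqueness for the Cauchy problem *)

Lemma mnm_ord_max0 n (m : 'X_{1..n.+1}) :
  m ord_max = 0%N ->
  m = mnmwiden [multinom m (widen_ord (leqnSn n) i) | i < n].
Proof.
move=> m0; apply/mnmP => i; have [j ->|->] := unliftP ord_max i.
  rewrite (_ : lift ord_max j = widen_ord (leqnSn n) j) ?mnmwiden_widen ?mnmE //.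
  by apply: val_inj; rewrite /= /bump leqNgt ltn_ord.
by rewrite mnmwiden_ordmax.
Qed.

(** The coefficient of t^e in the equation expresses e + 1 times the coefficient of t^(e+1) in [w]
    through those of t^0, ..., t^e, since derivatives in z keep the power of t. Induction on that
    power, with e + 1 invertible in characteristic 0. *)
Lemma transport_eq0 n (K : numFieldType) (w : mseries n.+1 K)
    (a : 'I_n -> mseries n.+1 K) :
  deriv_t w = dot a (grad_z w) -> at_t0 w = 0 -> w = 0.
Proof.
move=> wt w0; suff H d (m : 'X_{1..n.+1}) : (m ord_max < d)%N -> w m = 0.
  by apply: mseriesP => m; apply: (H (m ord_max).+1).
elim: d m => // d IH m md; case tm: (m ord_max) => [|e].
  rewrite (mnm_ord_max0 tm).
  exact: (congr1 (fun u : mseries n K => u _) w0).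
pose m' := (m - U_(ord_max))%MM.
have mE : m = (m' + U_(ord_max))%MM.
  by rewrite submK // lep1mP tm.
have m'e : m' ord_max = e by rewrite mnmBE mnm1E eqxx tm subn1.
have /eqP := congr1 (fun u : mseries n.+1 K => u m') wt.
rewrite /= -mE /dot scoef_sum big1 => [|k _].
  by rewrite Num.Theory.mulrn_eq0 /= => /eqP.
apply: big1 => -[[b _] [c _]] /= /eqP bc; rewrite IH ?mul0rn ?mulr0 //.
rewrite mnmDE mnm1E (_ : widen_ord _ k == ord_max = false) ?addn0; last first.
  by apply/eqP => /(congr1 val) /= kn; have := ltn_ord k; rewrite kn ltnn.
move: md; rewrite tm ltnS; apply: leq_trans; rewrite ltnS -m'e bc mnmDE.
exact: leq_addl.
Qed.

(** Since |grad U|^2 - |grad V|^2 = <grad(U + V), grad(U - V)>, the difference U - V solves a linear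
    transport equation with zero initial value. *)
Lemma cauchy_solution_unique n (K : numFieldType) (P : {mpoly K[n]})
    (U V : mseries n.+1 K) :
  cauchy_solution P U -> cauchy_solution P V -> U = V.
Proof.
move=> [Ut U0] [Vt V0]; apply/eqP; rewrite -subr_eq0; apply/eqP.
have gB i : grad_z (U - V) i = grad_z U i - grad_z V i.
  by apply: mseriesP => m /=; rewrite mulrnBl.
apply: (@transport_eq0 _ _ _ (fun i => 2^-1 *: (grad_z U i + grad_z V i))).
  have -> : deriv_t (U - V) = deriv_t U - deriv_t V.
    by apply: mseriesP => m /=; rewrite mulrnBl.
  rewrite Ut Vt /dot -scalerBr -sumrB scaler_sumr; apply: eq_bigr => i _.
  rewrite gB !msscaleE; ring.
have -> : at_t0 (U - V) = at_t0 U - at_t0 V by [].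
by rewrite U0 V0 subrr.
Qed.

(** * Keller maps and one-sided inverses *)

(** The determinant is a unit, that is a nonzero constant, rather than 1: in this form the condition
    passes through each reduction by a factorization of the Jacobian matrix. *)
Definition keller n (K : fieldType) (F : 'I_n -> {mpoly K[n]}) : Prop :=
  jacobian F \in unitmx.

(** This says F(G(z)) = z. One side is enough to carry through the reductions; [right_inverse_left]
    supplies the other at the end. *)
Definition right_invertible n (K : fieldType) (F : 'I_n -> {mpoly K[n]}) : Prop :=
  exists G : 'I_n -> {mpoly K[n]}, forall i, msubst G (F i) = 'X_i.

Lemma map_mx_unitmx n (R S : comUnitRingType) (f : {rmorphism R -> S})
    (A : 'M[R]_n) : A \in unitmx -> map_mx f A \in unitmx.
Proof. by rewrite !unitmxE det_map_mx => /(rmorph_unit f). Qed.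

Lemma msize_mderiv n (K : nzRingType) (p : {mpoly K[n]}) i d :
  (msize p <= d.+1)%N -> (msize p^`M(i) <= d)%N.
Proof.
move=> pd; rewrite msizeE; apply/bigmax_leqP_seq => m.
rewrite mcoeff_msupp mcoeff_deriv => nz _.
have /msize_mdeg_lt : (m + U_(i))%MM \in msupp p.
  by rewrite mcoeff_msupp; apply: contraNneq nz => ->; rewrite mul0rn.
by rewrite mdegD mdeg1 addn1 => /leq_trans /(_ pd).
Qed.

Lemma mderiv_eq0_const n (K : numFieldType) (p : {mpoly K[n]}) :
  (forall i, p^`M(i) = 0) -> p = (p@_0%MM)%:MP.
Proof.
move=> dp; apply/mpolyP => m; rewrite mcoeffC.
have [->|m0] := eqVneq m 0%MM; first by rewrite mulr1.
have [i mi] : exists i, m i != 0%N.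
  apply/existsP; apply: contra_neqT m0 => /existsPn m0; apply/mnmP => i.
  by apply/eqP; rewrite mnm0E -[_ == _]negbK m0.
have := congr1 (mcoeff (m - U_(i))%MM) (dp i).
rewrite mcoeff_deriv submK ?lep1mP // mcoeff0 mulr0 => /eqP.
by rewrite Num.Theory.mulrn_eq0 => /eqP.
Qed.

(* If p(G) = 0, differentiating gives (grad p)(G) = 0 since JG is invertible, so
   that p vanishes by induction on its degree. *)
Lemma right_inverse_left n (K : numFieldType) (F G : 'I_n -> {mpoly K[n]}) :
  (forall i, msubst G (F i) = 'X_i) -> forall i, msubst F (G i) = 'X_i.
Proof.
move=> FG.
have JG : jacobian G \in unitmx.
  have /mulmx1_unit[] //: map_mx (msubst G) (jacobian F) *m jacobian G = 1%:M.
  have := jacobian_msubst F G.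
  rewrite [X in _ = X *m _](_ : _ = map_mx (msubst G) (jacobian F)); last first.
    by apply/matrixP => i j; rewrite !mxE.
  by move=> <-; apply/matrixP => i j; rewrite !mxE FG mderivXX.
have inj d p : (msize p <= d)%N -> msubst G p = 0 -> p = 0.
  elim: d p => [p|d IH p pd Gp].
    by rewrite leqn0 msize_poly_eq0 => /eqP.
  have dp i : p^`M(i) = 0.
    apply: IH; first exact: msize_mderiv.
    pose r : 'rV_n := \row_j msubst G p^`M(j).
    suff r0 : r = 0 by have /rowP /(_ i) := r0; rewrite !mxE.
    rewrite -[r](mulmxK JG) (_ : r *m _ = 0) ?mul0mx //.
    apply/rowP => j; rewrite !mxE; have := mderiv_msubst G j p.
    rewrite Gp mderiv0 => E; rewrite [RHS]E.
    by apply: eq_bigr => k _; rewrite !mxE.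
  move: Gp; rewrite (mderiv_eq0_const dp) msubstC => /(congr1 (mcoeff 0%MM)).
  by rewrite mcoeffC eqxx mulr1 mcoeff0 => ->; rewrite mpolyC0.
(* Take p = G_i(F) - z_i, for which p(G) = G_i(F(G)) - G_i = 0. *)
move=> i; apply/eqP; rewrite -subr_eq0; apply/eqP/(inj _ _ (leqnn _)).
rewrite rmorphB /= msubst_comp msubstX.
by rewrite (msubst_ext FG) msubst_id subrr.
Qed.

(** * Nilpotency of M against invertibility of 1 - M *)

Lemma nilpotent_unitmx n (R : comUnitRingType) (A : 'M[R]_n) :
  nilpotent_mx A -> 1%:M - A \in unitmx.
Proof.
move=> [k Ak]; have := subrX1 A k; rewrite Ak sub0r => E.
have /mulmx1_unit[] // : (1%:M - A) *m (\sum_(i < k) A ^+ i) = 1%:M.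
by rewrite -[LHS]/((1 - A) * _) -opprB mulNr -E opprK.
Qed.

Lemma nilpotent_mx_map n (R S : comNzRingType) (f : {rmorphism R -> S})
    (A : 'M[R]_n) c : nilpotent_mx A -> nilpotent_mx (c *: map_mx f A).
Proof.
move=> [k Ak]; exists k; suff -> j : (c *: map_mx f A) ^+ j = c ^+ j *: map_mx f (A ^+ j).
  by rewrite Ak map_mx0 scaler0.
elim: j => [|j IH]; first by rewrite !expr0 scale1r map_mx1.
rewrite !exprS IH -!mulmxE map_mxM -scalemxAl -scalemxAr scalerA.
by rewrite -exprS.
Qed.

(** [sc] substitutes s z for z, the indeterminate of [{poly _}] being s, so that the degree in z can
    be read off as a power of s. *)
Lemma homog_scaling n (K : comNzRingType) :
  exists sc : {rmorphism {mpoly K[n]} -> {poly {mpoly K[n]}}},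
  forall d p, p \is d.-homog -> sc p = p%:P * 'X ^+ d.
Proof.
exists (mmap (polyC \o @mpolyC n K) (fun i => 'X * ('X_i)%:P)) => d p ph /=.
rewrite (mmap_homog _ _ _ ph) mulrC; congr (_ * _).
rewrite -[X in mmap _ X](_ : polyC \o (fun i => 'X_i) = _) //.
rewrite -(rmorph_mmap (polyC : {rmorphism _ -> _})) /=.
by congr (_%:P); exact: msubst_id.
Qed.

(* Substituting s z for z turns the inverse B of 1 - M into a polynomial in s
   with 1 = (1 - s^e M) B(s z); hence the coefficient of s^(k e) is M^k. *)
Lemma homog_unitmx_nilpotent n (K : fieldType) (M : 'M[{mpoly K[n]}]_n) e :
  (forall i j, M i j \is e.+1.-homog) -> 1%:M - M \in unitmx -> nilpotent_mx M.
Proof.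
move=> Mh MU; set B := invmx (1%:M - M).
have [sc scH] := homog_scaling n K.
pose C s : 'M_n := \matrix_(i, j) (sc (B i j))`_s.
have scB i j s : (sc (B i j))`_s
    - \sum_k M i k * (if (s < e.+1)%N then 0 else (sc (B k j))`_(s - e.+1))
    = (s == 0%N)%:R *+ (i == j).
  have /matrixP /(_ i j) : (1%:M - M) *m B = 1%:M by rewrite mulmxV.
  rewrite mulmxBl mul1mx !mxE => /(congr1 (coefp s \o sc)) /=.
  rewrite rmorphB /= coefB rmorph_sum coef_sum rmorph_nat coefMn coef1 => <-.
  congr (_ - _); apply: eq_bigr => k _.
  by rewrite rmorphM /= (scH _ _ (Mh i k)) -mulrA coefCM coefXnM.
have C0 : C 0%N = 1%:M.
  apply/matrixP => i j; rewrite !mxE; have := scB i j 0%N.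
  by rewrite big1 ?subr0 // => k _; rewrite mulr0.
have CS s : C (s + e.+1)%N = M *m C s.
  apply/matrixP => i j; rewrite !mxE; have := scB i j (s + e.+1)%N.
  rewrite {4}addnS mul0rn => /eqP; rewrite subr_eq0 => /eqP ->.
  by apply: eq_bigr => k _; rewrite ltnNge leq_addl /= addnK !mxE.
(* The entries of B(s z) have size at most [k] as polynomials in s, so their coefficients of index
   [k * e.+1], which is at least [k], vanish. *)
pose k := \max_i \max_j size (sc (B i j)); exists k.
have CE m : C (m * e.+1)%N = M ^+ m.
  elim: m => [|m IH]; first by rewrite C0.
  by rewrite mulSn addnC CS IH exprS.
rewrite -CE; apply/matrixP => i j; rewrite !mxE nth_default //.
apply: leq_trans (leq_pmulr k (ltn0Sn e)).
apply: leq_trans (leq_bigmax i).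
exact: (leq_bigmax (F := fun j => size (sc (B i j)))).
Qed.

(** * Polynomial solutions of the Cauchy problem *)

Local Notation widen := (widen_ord (leqnSn _)).

Section AtTime.
Variables (n : nat) (K : numFieldType).
Implicit Types (P : {mpoly K[n]}) (u : {mpoly K[n.+1]}).

Definition time_point (c : K) (i : 'I_n.+1) : {mpoly K[n]} :=
  if unlift ord_max i is Some j then 'X_j else c%:MP.

Lemma lift_max_widen (j : 'I_n) : lift ord_max j = widen j.
Proof. by apply: val_inj; rewrite /= /bump leqNgt ltn_ord. Qed.

Lemma widen_neq_max (j : 'I_n) : (widen j == ord_max) = false.
Proof. by rewrite -lift_max_widen eq_sym (negPf (neq_lift _ _)). Qed.

Lemma max_neq_widen (j : 'I_n) : (ord_max == widen j) = false.
Proof. by rewrite eq_sym widen_neq_max. Qed.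

Lemma widen_eq (i j : 'I_n) : (widen i == widen j) = (i == j).
Proof. by rewrite -!lift_max_widen (inj_eq lift_inj). Qed.

Lemma time_point_widen c j : time_point c (widen j) = 'X_j.
Proof. by rewrite /time_point -lift_max_widen liftK. Qed.

Lemma time_point_max c : time_point c ord_max = c%:MP.
Proof. by rewrite /time_point unlift_none. Qed.

Lemma mderiv_time_point c u i :
  (msubst (time_point c) u)^`M(i) = msubst (time_point c) u^`M(widen i).
Proof.
rewrite mderiv_msubst big_ord_recr /= time_point_max mderivC mulr0 addr0.
rewrite (bigD1 i) //= time_point_widen mderivXX eqxx mulr1 big1 ?addr0 // => j ji.
by rewrite time_point_widen mderivXX (negPf ji) mulr0.
Qed.

Lemma at_t0_poly u :
  at_t0 (series_of_mpoly u) = series_of_mpoly (msubst (time_point 0) u).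
Proof.
apply: mseriesP => m /=; elim/mpolyind: u => [|c l u _ _ IH].
  by rewrite rmorph0 !mcoeff0.
rewrite rmorphD /= !mcoeffD IH msubstZ !mcoeffZ; congr (_ * _ + _).
rewrite mcoeffX /msubst mmapX /mmap1 big_ord_recr /= time_point_max mpolyC0.
case lm: (l ord_max) => [|e]; last first.
  rewrite exprS mul0r mulr0 mcoeff0; case: eqP => // lE.
  by move: lm; rewrite lE mnmwiden_ordmax.
rewrite expr0 mulr1 {1}(mnm_ord_max0 lm) (inj_eq (@inj_mnmwiden n)).
rewrite -mcoeffX mpolyXE_id; congr (mcoeff _ _).
by apply: eq_bigr => j _; rewrite mnmE time_point_widen.
Qed.

Lemma deriv_t_poly u : deriv_t (series_of_mpoly u) = series_of_mpoly u^`M(ord_max).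
Proof. exact: msderiv_poly. Qed.

Lemma grad_z_poly u i : grad_z (series_of_mpoly u) i = series_of_mpoly u^`M(widen i).
Proof. exact: msderiv_poly. Qed.

Lemma dot_poly (a b : 'I_n -> {mpoly K[n.+1]}) :
  dot (fun i => series_of_mpoly (a i)) (fun i => series_of_mpoly (b i))
  = series_of_mpoly (dot a b).
Proof. by rewrite /dot rmorph_sum; apply: eq_bigr => i _; rewrite rmorphM. Qed.

Lemma cauchy_solution_poly P u :
  cauchy_solution P (series_of_mpoly u) <->
  u^`M(ord_max) = 2^-1 *: \sum_(i < n) u^`M(widen i) * u^`M(widen i) /\
  msubst (time_point 0) u = P.
Proof.
have gE : grad_z (series_of_mpoly u) = fun i => series_of_mpoly u^`M(widen i).
  by apply: funext => i; rewrite grad_z_poly.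
rewrite /cauchy_solution deriv_t_poly at_t0_poly gE dot_poly -series_of_mpolyZ.
by split=> [[/series_of_mpoly_inj ut /series_of_mpoly_inj u0] //|[-> ->]].
Qed.

(* With N = grad U, the transport operator d/dt - <N, grad> kills both N and
   z + t N, hence also (grad P)(z + t N) - N, which vanishes at t = 0. *)
Lemma cauchy_grad_fixpoint P u :
  cauchy_solution P (series_of_mpoly u) ->
  forall i, msubst (fun j => 'X_(widen j) + 'X_ord_max * u^`M(widen j)) P^`M(i)
            = u^`M(widen i).
Proof.
move=> /cauchy_solution_poly[ut u0] i.
pose N j := u^`M(widen j); set V := fun j => _ + _.
(* Differentiating the equation for [u] in z_j gives dN_j/dt = <N, grad N_j>; the factor 2 from the
   square cancels the 1/2. *)
have Nt j : (N j)^`M(ord_max) = \sum_k N k * (N j)^`M(widen k).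
  rewrite /N mderiv_comm ut mderivZ (raddf_sum (mderiv (widen j))) scaler_sumr; apply: eq_bigr => k _ /=.
  rewrite mderivM (mderiv_comm (widen j)) mulrC -mulr2n -scaler_nat scalerA.
  by rewrite mulVf ?scale1r // Num.Theory.pnatr_eq0.
have Vt j : (V j)^`M(ord_max) = \sum_k N k * (V j)^`M(widen k).
  rewrite /V mderivD mderivXX widen_neq_max add0r mderivM mderivXX eqxx mul1r.
  rewrite Nt mulr_sumr.
  under [RHS]eq_bigr => k _ do rewrite mderivD mderivM !mderivXX
    max_neq_widen mul0r add0r mulrDr widen_eq.
  rewrite big_split /= [X in _ = X + _](bigD1 j) //= eqxx mulr1.
  rewrite [X in _ = _ + X + _]big1 ?addr0.
    by congr (_ + _); apply: eq_bigr => k _; rewrite mulrCA.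
  by move=> k kj; rewrite eq_sym (negPf kj) mulr0.
pose w := msubst V P^`M(i) - N i.
suff w0 : series_of_mpoly w = 0.
  apply/eqP; rewrite -subr_eq0; apply/eqP/series_of_mpoly_inj.
  by rewrite -[LHS]/(series_of_mpoly w) w0 rmorph0.
apply: (@transport_eq0 n K _ (fun k => series_of_mpoly (N k))).
  have gE : grad_z (series_of_mpoly w) = fun k => series_of_mpoly w^`M(widen k).
    by apply: funext => k; rewrite grad_z_poly.
  rewrite deriv_t_poly gE dot_poly /dot; congr series_of_mpoly.
  rewrite /w mderivB Nt mderiv_msubst.
  under [RHS]eq_bigr => k _ do rewrite mderivB mulrBr mderiv_msubst mulr_sumr.
  rewrite sumrB; congr (_ - _); rewrite exchange_big /=; apply: eq_bigr => j _.
  by rewrite Vt mulr_sumr; apply: eq_bigr => k _; rewrite mulrCA.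
rewrite at_t0_poly -(rmorph0 (@series_of_mpoly n K)); congr series_of_mpoly.
rewrite /w rmorphB /= -mderiv_time_point u0 msubst_comp.
rewrite (msubst_ext (w := fun j => 'X_j)) ?msubst_id ?subrr // => j.
rewrite /V rmorphD rmorphM /= !msubstX time_point_widen time_point_max.
by rewrite mpolyC0 mul0r addr0.
Qed.

(** At t = 1 the fixed point equation reads (grad P)(G) = N with G = z + N, that is G - (grad P)(G)
    = z. *)
Lemma cauchy_right_invertible P u :
  cauchy_solution P (series_of_mpoly u) ->
  right_invertible (fun i => 'X_i - P^`M(i)).
Proof.
move=> /cauchy_grad_fixpoint uE.
exists (fun i => 'X_i + msubst (time_point 1) u^`M(widen i)) => i.
rewrite rmorphB /= msubstX; set G := fun _ => _.
suff -> : msubst G P^`M(i) = msubst (time_point 1) u^`M(widen i) by rewrite addrK.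
rewrite -(uE i) msubst_comp; apply: msubst_ext => j.
rewrite rmorphD rmorphM /= !msubstX time_point_widen time_point_max mpolyC1.
by rewrite mul1r.
Qed.

(* The Hopf-Lax formula: U = P(G) - t/2 |N|^2 with N = (grad P)(G), G = z + t N. *)
Lemma hopf_lax P (G : 'I_n -> {mpoly K[n.+1]}) :
  (forall i, G i = 'X_(widen i) + 'X_ord_max * msubst G P^`M(i)) ->
  cauchy_solution P (series_of_mpoly (msubst G P
    - 'X_ord_max * (2^-1 *: \sum_i msubst G P^`M(i) * msubst G P^`M(i)))).
Proof.
move=> GE; set N := fun i => msubst G P^`M(i).
have dN2 k : (2^-1 *: \sum_i N i * N i)^`M(k) = \sum_i N i * (N i)^`M(k).
  rewrite mderivZ (raddf_sum (mderiv k)) scaler_sumr; apply: eq_bigr => i _ /=.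
  rewrite mderivM mulrC -mulr2n -scaler_nat scalerA.
  by rewrite mulVf ?scale1r // Num.Theory.pnatr_eq0.
have dG i k : (G i)^`M(k) = (widen i == k)%:R
    + ((ord_max == k)%:R * N i + 'X_ord_max * (N i)^`M(k)).
  by rewrite GE mderivD mderivM !mderivXX.
set u := _ - _.
(* The chain rule for P(G) and the derivative of t/2 |N|^2 both produce t <N, dN>. These terms
   cancel, leaving grad U = N in z and dU/dt = |N|^2 - |N|^2 / 2. *)
have du k : u^`M(k) = \sum_i N i * (widen i == k)%:R
   + (ord_max == k)%:R * (2^-1 *: \sum_i N i * N i).
  have T2 : \sum_i N i * N i = 2^-1 *: (\sum_i N i * N i) *+ 2.
    by rewrite -scaler_nat scalerA mulfV ?scale1r // Num.Theory.pnatr_eq0.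
  have sG : \sum_i N i * (G i)^`M(k) = \sum_i N i * (widen i == k)%:R
      + (ord_max == k)%:R * (\sum_i N i * N i)
      + 'X_ord_max * \sum_i N i * (N i)^`M(k).
    rewrite !mulr_sumr -!big_split /=; apply: eq_bigr => i _; rewrite dG; ring.
  rewrite /u mderivB mderivM dN2 mderivXX mderiv_msubst -/N sG {1}T2; ring.
apply/cauchy_solution_poly; split.
  rewrite du big1 ?add0r => [|i _]; last by rewrite widen_neq_max mulr0.
  rewrite eqxx mul1r; congr (_ *: _); apply: eq_bigr => i _.
  suff -> : u^`M(widen i) = N i by [].
  rewrite du max_neq_widen mul0r addr0 (bigD1 i) //= eqxx mulr1.
  by rewrite big1 ?addr0 // => j ji; rewrite widen_eq (negPf ji) mulr0.
rewrite /u rmorphB rmorphM /= !msubstX time_point_max mpolyC0 mul0r subr0.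
rewrite msubst_comp (msubst_ext (w := fun j => 'X_j)) ?msubst_id // => j.
rewrite GE rmorphD rmorphM /= !msubstX time_point_widen time_point_max.
by rewrite mpolyC0 mul0r addr0.
Qed.

End AtTime.

(** * From (B) to (A) *)

(** Assertion (A) over [K], followed by (B). Only the deduction of (B) from (A) takes [K]
    algebraically closed, for a square root of -1. *)
Definition homogeneous_cauchy_polynomial (K : numFieldType) : Prop :=
  forall (n : nat) (P : {mpoly K[n]}),
    (1 <= n)%N -> P \is 4.-homog -> nilpotent_mx (hessian P) ->
    exists U : mseries n.+1 K, unique (cauchy_solution P) U /\ is_polynomial U.

Definition jacobian_conjecture (K : numFieldType) : Prop :=
  forall (n : nat) (H : 'I_n -> {mpoly K[n]}),
    (1 <= n)%N -> (forall i, (H i)@_0%MM = 0) ->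
    let F := fun i : 'I_n => 'X_i - H i in
    \det (jacobian F) = 1 ->
    exists G : 'I_n -> mseries n K,
      unique (is_formal_inverse F) G /\ forall i, is_polynomial (G i).

(** The determinant is a unit of a polynomial ring over a field, hence constant, and so equals its
    value at the origin, where [s] vanishes and the matrix is 1. *)
Lemma det_sub_nilpotent n (K : fieldType) (A : 'M[{mpoly K[n]}]_n) m
    (v : 'I_n -> {mpoly K[m]}) (s : {mpoly K[m]}) :
  nilpotent_mx A -> s@_0%MM = 0 -> \det (1%:M - s *: map_mx (msubst v) A) = 1.
Proof.
move=> nilA s0; set B := 1%:M - _.
have : B \in unitmx by apply/nilpotent_unitmx/nilpotent_mx_map.
rewrite unitmxE => /andP[/eqP -> _]; rewrite -[X in X%:MP](det_map_mx (mcoeff 0%MM)).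
rewrite [map_mx _ _](_ : _ = 1%:M) ?det1 //; apply/matrixP => i j.
by rewrite mxE /B !mxE rmorphB rmorphM /= s0 mul0r subr0 rmorph_nat.
Qed.

Lemma jacobian_conjecture_cauchy (K : numFieldType) :
  jacobian_conjecture K -> homogeneous_cauchy_polynomial K.
Proof.
move=> JC n P n1 _ nilP.
pose emb (p : {mpoly K[n]}) : {mpoly K[n.+1]} := msubst (fun j => 'X_(widen j)) p.
pose H i : {mpoly K[n.+1]} :=
  if unlift ord_max i is Some j then 'X_ord_max * emb P^`M(j) else 0.
have Hw j : H (widen j) = 'X_ord_max * emb P^`M(j).
  by rewrite /H -lift_max_widen liftK.
have Hmax : H ord_max = 0 by rewrite /H unlift_none.
have X0 : ('X_ord_max : {mpoly K[n.+1]})@_0%MM = 0 by rewrite mcoeffX mnm1_eq0.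
have H0 i : (H i)@_0%MM = 0.
  rewrite /H; case: unlift => [j|]; last exact: mcoeff0.
  by rewrite -[LHS]/(mcoeff 0%MM _) rmorphM /= X0 mul0r.
pose F i := 'X_i - H i.
have dF : \det (jacobian F) = 1.
  (* F fixes t, so the last row of its Jacobian is that of the identity, and the remaining minor is
     the determinant of 1 - t Hess P. *)
  rewrite (expand_det_row _ ord_max) (bigD1 ord_max) //= big1 ?addr0 => [|j jm].
    rewrite !mxE /F Hmax subr0 mderivXX eqxx mul1r /cofactor -signr_odd addnn.
    rewrite odd_double expr0 mul1r.
    rewrite -(@det_sub_nilpotent _ _ _ n.+1 (fun j => 'X_(widen j)) 'X_ord_max nilP X0).
    congr (\det _); apply/matrixP => i j; rewrite !mxE /F !lift_max_widen Hw.
    rewrite mderivB mderivXX widen_eq mderivM mderivXX max_neq_widen mul0r add0r.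
    congr (_ - _ * _); rewrite mderiv_comm mderiv_msubst (bigD1 j) //= big1.
      by rewrite mderivXX eqxx mulr1 addr0.
    by move=> k kj; rewrite mderivXX widen_eq (negPf kj) mulr0.
  by rewrite !mxE /F Hmax subr0 mderivXX eq_sym (negPf jm) mul0r.
have [G [[[FG GF] _] Gp]] := JC n.+1 H isT H0 dF.
have [g gE] : exists g : 'I_n.+1 -> {mpoly K[n.+1]},
    forall i, G i = series_of_mpoly (g i) by exact: (fin_all_exists Gp).
have {}FG i : msubst g (F i) = 'X_i.
  apply: series_of_mpoly_inj; rewrite -FG mscomp_poly; last first.
    exact: formal_inverse_coef0 GF.
  by rewrite -seval_poly; apply: seval_ext => j; rewrite gE.
have gmax : g ord_max = 'X_ord_max.
  by rewrite -FG /F Hmax subr0 msubstX.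
(* The z-components of F(G) = z are exactly the fixed point equation required by [hopf_lax]. *)
have gw i : g (widen i) = 'X_(widen i)
    + 'X_ord_max * msubst (fun j => g (widen j)) P^`M(i).
  rewrite -(FG (widen i)) /F Hw rmorphB rmorphM /= !msubstX gmax msubst_comp.
  rewrite (msubst_ext (w := fun j => g (widen j))) ?subrK // => j.
  by rewrite msubstX.
have sol := hopf_lax gw; set u := _ - _ in sol.
exists (series_of_mpoly u); split; last by exists u.
by split=> // V; apply: cauchy_solution_unique.
Qed.

(** * From (A) to (B): gradient maps *)

(** The Jacobian matrix is 1 - Hess P with quadratic homogeneous entries in Hess P; its
    invertibility therefore makes Hess P nilpotent, and (A) applies. *)
Lemma gradient_right_invertible (K : numFieldType) n (P : {mpoly K[n]}) :
  homogeneous_cauchy_polynomial K -> (0 < n)%N -> P \is 4.-homog ->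
  keller (fun i => 'X_i - P^`M(i)) -> right_invertible (fun i => 'X_i - P^`M(i)).
Proof.
move=> A n0 P4; rewrite /keller (_ : jacobian _ = 1%:M - hessian P); last first.
  by apply/matrixP => i j; rewrite !mxE mderivB mderivXX mderiv_comm.
have Hh i j : hessian P i j \is 2.-homog.
  by rewrite mxE; do 2!apply: mderiv_homog.
move=> /(homog_unitmx_nilpotent Hh) /(A n P n0 P4) [U [[sol _] [u uE]]].
by apply: (@cauchy_right_invertible _ _ _ u); rewrite -uE.
Qed.

Definition ord_sum_case (T : Type) m n (f : 'I_m -> T) (g : 'I_n -> T) (s : 'I_(m + n)) :=
  match split s with inl i => f i | inr j => g j end.

Lemma ord_sum_caseL (T : Type) m n (f : 'I_m -> T) (g : 'I_n -> T) i :
  ord_sum_case f g (lshift n i) = f i.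
Proof. by rewrite /ord_sum_case; have := unsplitK (inl i : 'I_m + 'I_n) => /= ->. Qed.

Lemma ord_sum_caseR (T : Type) m n (f : 'I_m -> T) (g : 'I_n -> T) j :
  ord_sum_case f g (rshift m j) = g j.
Proof. by rewrite /ord_sum_case; have := unsplitK (inr j : 'I_m + 'I_n) => /= ->. Qed.

Lemma jacobian_block (K : nzRingType) m n (F : 'I_(m + n) -> {mpoly K[m + n]}) :
  jacobian F = block_mx
    (\matrix_(i, j) (F (lshift n i))^`M(lshift n j))
    (\matrix_(i, j) (F (lshift n i))^`M(rshift m j))
    (\matrix_(i, j) (F (rshift m i))^`M(lshift n j))
    (\matrix_(i, j) (F (rshift m i))^`M(rshift m j)).
Proof.
by rewrite -[LHS]submxK; congr block_mx; apply/matrixP => i j; rewrite !mxE.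
Qed.

(** * Embedding z - H in a gradient map *)

Section SymmetricReduction.
Variables (n : nat) (K : numFieldType) (im : K) (H : 'I_n -> {mpoly K[n]}).
Hypothesis im2 : im * im = -1.

Let R := {mpoly K[n + n]}.
Let c : R := im%:MP.
Let h : R := 2^-1%:MP.
Let x k : R := 'X_(lshift n k).
Let y k : R := 'X_(rshift n k).
Let zeta k : R := x k + c * y k.
Let om k : R := h * (x k - c * y k).
Let e : {mpoly K[n]} -> R := msubst zeta.

(** The factor 1/2 in [om] and c^2 = -1 give dP/dx_k + c dP/dy_k = H_k(zeta), so the map z - grad P
    sends zeta to zeta - H(zeta). *)
Definition potential : R := \sum_j om j * e (H j).

Local Lemma cc : c * c = -1.
Proof. by rewrite /c -mpolyCM im2 mpolyCN mpolyC1. Qed.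

Local Lemma hh : h + h = 1.
Proof.
by rewrite /h -mpolyCD -mulr2n -[2^-1 *+ 2]mulr_natr mulVf ?mpolyC1 // Num.Theory.pnatr_eq0.
Qed.

Local Lemma shift_eq (i j : 'I_n) :
  ((lshift n i == lshift n j) = (i == j)) * ((rshift n i == rshift n j) = (i == j))
  * ((lshift n i == rshift n j) = false) * ((rshift n i == lshift n j) = false).
Proof. by rewrite !eq_shift. Qed.

Local Lemma deL p k : (e p)^`M(lshift n k) = e p^`M(k).
Proof.
rewrite /e mderiv_msubst (bigD1 k) //= big1 => [|j jk];
  rewrite /zeta mderivD mderivM mderivC !mderivXX !shift_eq ?eqxx.
  by rewrite mul0r mulr0 !addr0 mulr1.
by rewrite (negPf jk) mul0r mulr0 !addr0 mulr0.
Qed.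

Local Lemma deR p k : (e p)^`M(rshift n k) = c * e p^`M(k).
Proof.
rewrite /e mderiv_msubst (bigD1 k) //= big1 => [|j jk];
  rewrite /zeta mderivD mderivM mderivC !mderivXX !shift_eq ?eqxx.
  by rewrite mul0r mulr1 !add0r addr0 mulrC.
by rewrite (negPf jk) mul0r mulr0 !addr0 mulr0.
Qed.

Local Lemma dom j k : (om j)^`M(lshift n k) = h * (j == k)%:R
  /\ (om j)^`M(rshift n k) = - (h * c) * (j == k)%:R.
Proof.
rewrite /om !mderivM !mderivB !mderivM !mderivC !mderivXX !shift_eq.
by split; rewrite /= ?mulr0n; ring.
Qed.

Local Lemma dhc s : (- (h * c))^`M(s) = 0.
Proof. by rewrite /h /c -mpolyCM -mpolyCN mderivC. Qed.

Let D k := \sum_j om j * e (H j)^`M(k).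

Local Lemma dPL k : potential^`M(lshift n k) = h * e (H k) + D k.
Proof.
rewrite /potential raddf_sum /=.
under eq_bigr => j _ do rewrite mderivM deL (dom j k).1.
rewrite big_split /= (bigD1 k) //= eqxx mulr1 [X in _ + X + _]big1 ?addr0 //.
by move=> j jk; rewrite (negPf jk) mulr0 mul0r.
Qed.

Local Lemma dPR k : potential^`M(rshift n k) = - (h * c) * e (H k) + c * D k.
Proof.
rewrite /potential raddf_sum /= /D mulr_sumr.
under eq_bigr => j _ do rewrite mderivM deR (dom j k).2 [_ * (c * _)]mulrCA.
rewrite big_split /= (bigD1 k) //= eqxx mulr1 [X in _ + X + _]big1 ?addr0 //.
by move=> j jk; rewrite (negPf jk) mulr0 mul0r.
Qed.

Let A k l := e (H k)^`M(l).
Let C k l := \sum_j om j * e (H j)^`M(k)^`M(l).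

Local Lemma dDL k l : (D k)^`M(lshift n l) = h * A l k + C k l.
Proof.
rewrite /D raddf_sum /=.
under eq_bigr => j _ do rewrite mderivM deL (dom j l).1.
rewrite big_split /= (bigD1 l) //= eqxx mulr1 [X in _ + X + _]big1 ?addr0 //.
by move=> j jl; rewrite (negPf jl) mulr0 mul0r.
Qed.

Local Lemma dDR k l : (D k)^`M(rshift n l) = - (h * c) * A l k + c * C k l.
Proof.
rewrite /D raddf_sum /= /C mulr_sumr.
under eq_bigr => j _ do rewrite mderivM deR (dom j l).2 [_ * (c * _)]mulrCA.
rewrite big_split /= (bigD1 l) //= eqxx mulr1 [X in _ + X + _]big1 ?addr0 //.
by move=> j jl; rewrite (negPf jl) mulr0 mul0r.
Qed.

Lemma potential_homog d : (forall k, H k \is d.-homog) -> potential \is d.+1.-homog.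
Proof.
have Xh s : ('X_s : R) \is 1.-homog by rewrite dhomogX /= mdeg1.
have zh k : zeta k \is 1.-homog.
  by rewrite /zeta /c mul_mpolyC rpredD ?rpredZ ?Xh.
move=> Hh; apply: rpred_sum => k _; rewrite -add1n; apply: dhomogM.
  by rewrite /om /h /c !mul_mpolyC rpredZ ?rpredB ?rpredZ ?Xh.
exact: msubst_linear_homog.
Qed.

(** In the coordinates (zeta, y), that is after conjugation by the unipotent block matrix with
    corner c, the Jacobian is block lower triangular with diagonal blocks 1 - A and 1 - A^T, where A
    is the Jacobian of H at zeta. *)
Lemma potential_keller :
  keller (fun i => 'X_i - H i) -> keller (fun s => 'X_s - potential^`M(s)).
Proof.
rewrite /keller => JU.
pose Am : 'M[R]_n := \matrix_(k, l) A k l.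
pose S10 : 'M[R]_n :=
  \matrix_(k, l) (- (h * c) * A k l + c * (h * A l k + C k l)).
have AU : 1%:M - Am \in unitmx.
  rewrite -[1%:M - Am](_ : map_mx (msubst zeta) (jacobian (fun i => 'X_i - H i)) = _).
    exact: map_mx_unitmx.
  by apply/matrixP => i j; rewrite !mxE mderivB mderivXX rmorphB rmorph_nat.
rewrite (_ : jacobian _ = block_mx 1%:M (- c)%:M 0 1%:M *m
   (block_mx (1%:M - Am) 0 (- S10) (1%:M - Am^T) *m block_mx 1%:M c%:M 0 1%:M)).
  rewrite unitmxE !det_mulmx !det_ublock det_lblock !det1 !mul1r ?mulr1.
  rewrite -[1%:M - Am^T](_ : (1%:M - Am)^T = _); last by rewrite linearB /= trmx1.
  by rewrite det_tr unitrM -unitmxE AU.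
rewrite jacobian_block !mulmx_block !mulmx0 !mul0mx !mulmx1 !mul1mx.
rewrite !addr0 !add0r !mul_scalar_mx !mul_mx_scalar.
congr block_mx; apply/matrixP => k l; rewrite !mxE mderivB mderivXX shift_eq.
- rewrite dPL mderivD mderivM mderivC mul0r add0r deL dDL -/(A k l).
  apply/eqP; rewrite -subr_eq0; apply/eqP; set a := _%:R.
  (* The difference is written as a combination of 1 - (h + h) and c * c + 1, which [hh] and [cc]
     then turn into 0; likewise for the blocks below that need it. *)
  transitivity ((1 - (h + h)) * A k l + (c * c + 1) * (h * (A k l - A l k) - C k l)).
    ring.
  by rewrite hh cc; ring.
- rewrite dPL mderivD mderivM mderivC mul0r add0r deR dDR -/(A k l).
  apply/eqP; rewrite -subr_eq0; apply/eqP; set a := (_ == _)%:R; rewrite /= ?mulr0n.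
  transitivity ((1 - (h + h)) * (c * (A k l - A l k))
    - (c * c + 1) * (- (h * c) * A k l + c * (h * A l k + C k l))).
    ring.
  by rewrite hh cc; ring.
- rewrite dPR mderivD !mderivM dhc mderivC deL dDL -/(A k l).
  rewrite /= ?mulr0n; ring.
- rewrite dPR mderivD !mderivM dhc mderivC deR dDR -/(A k l).
  apply/eqP; rewrite -subr_eq0; apply/eqP; set a := _%:R.
  transitivity ((1 - (h + h)) * A l k + (c * c + 1) * ((h + h) * A l k)).
    ring.
  by rewrite hh cc; ring.
Qed.

(** For a right inverse G of z - grad P, the series of components Z = zeta(G) satisfies Z - H(Z) =
    zeta. Setting y = 0 turns zeta into x and Z into a right inverse of x - H(x). *)
Lemma potential_right_invertible :
  right_invertible (fun s => 'X_s - potential^`M(s)) ->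
  right_invertible (fun i => 'X_i - H i).
Proof.
move=> [G GP].
have GE s : G s = 'X_s + msubst G potential^`M(s).
  by rewrite -[X in X + _](GP s) rmorphB /= msubstX subrK.
pose Z k := msubst G (zeta k).
have ZE k : Z k = zeta k + msubst Z (H k).
  have -> : msubst Z (H k) = msubst G (e (H k)) by rewrite msubst_comp.
  rewrite /Z [zeta k in LHS]/zeta rmorphD rmorphM /= !msubstX msubstC !GE.
  rewrite dPL dPR !(rmorphD, rmorphM, rmorphN) /= !msubstC -/c -/h /zeta /x /y.
  set a := msubst G (e _); set b := msubst G (D _).
  apply/eqP; rewrite -subr_eq0; apply/eqP.
  transitivity ((h + h - 1) * a + (c * c + 1) * (b - h * a)); first ring.
  by rewrite hh cc; ring.
pose tau := ord_sum_case (fun i => 'X_i : {mpoly K[n]}) (fun _ : 'I_n => 0).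
exists (fun k => msubst tau (Z k)) => i.
rewrite rmorphB /= msubstX -msubst_comp ZE rmorphD /= addrK.
rewrite /zeta rmorphD rmorphM /= !msubstX /tau ord_sum_caseL ord_sum_caseR.
by rewrite mulr0 addr0.
Qed.

End SymmetricReduction.

Lemma cubic_homogeneous_right_invertible (K : numClosedFieldType) n
    (H : 'I_n -> {mpoly K[n]}) :
  homogeneous_cauchy_polynomial K -> (forall i, H i \is 3.-homog) ->
  keller (fun i => 'X_i - H i) -> right_invertible (fun i => 'X_i - H i).
Proof.
(* (A) speaks only of n >= 1; in dimension 0 there is no component to check. *)
case: n H => [|n] H A H3 JU; first by exists (fun=> 0) => -[].
have im2 : 'i * 'i = -1 :> K by rewrite -expr2 Num.Theory.sqrCi.
apply/(potential_right_invertible im2)/gradient_right_invertible => //.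
  exact: potential_homog.
exact: potential_keller.
Qed.

(** * Stabilization by elementary automorphisms *)

Section Embeddings.
Variables (n k : nat) (K : fieldType).
Implicit Types p : {mpoly K[n]}.

Definition embl : {mpoly K[n]} -> {mpoly K[n + k]} :=
  msubst (fun i => 'X_(lshift k i)).

HB.instance Definition _ :=
  GRing.RMorphism.copy embl (msubst (fun i : 'I_n => 'X_(lshift k i) : {mpoly K[n + k]})).

Lemma mderiv_embll p j : (embl p)^`M(lshift k j) = embl p^`M(j).
Proof.
rewrite /embl mderiv_msubst (bigD1 j) //= big1 ?addr0 => [|i ij].
  by rewrite mderivXX eqxx mulr1.
by rewrite mderivXX eq_shift (negPf ij) mulr0.
Qed.

Lemma mderiv_emblr p s : (embl p)^`M(rshift n s) = 0.
Proof.
rewrite /embl mderiv_msubst big1 // => i _.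
by rewrite mderivXX eq_shift mulr0.
Qed.

Lemma msubst_embl l (g : 'I_n -> {mpoly K[l]}) (h : 'I_k -> {mpoly K[l]}) p :
  msubst (ord_sum_case g h) (embl p) = msubst g p.
Proof.
by rewrite msubst_comp; apply: msubst_ext => i; rewrite msubstX ord_sum_caseL.
Qed.

Section Stabilization.
Variables (f : 'I_n -> {mpoly K[n + k]}) (p : 'I_k -> {mpoly K[n]})
          (q : 'I_n -> {mpoly K[k]}).

Definition shifted_var s : {mpoly K[n + k]} := 'X_(rshift n s) + embl (p s).

(** The map (z, w) -> (f(z, w), w), preceded by (z, w) -> (z, w + p(z)) and followed by (z, w) -> (z
    - q(w), w). The variables w enter [f] as parameters. *)
Definition stabilization : 'I_(n + k) -> {mpoly K[n + k]} :=
  ord_sum_case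
    (fun i => msubst (ord_sum_case (fun j => 'X_(lshift k j)) shifted_var) (f i)
              - msubst shifted_var (q i))
    shifted_var.

(** Row operations with the last [k] rows (J, 1) remove everything that comes through w, so the
    determinant is that of the Jacobian of [f] in z alone, evaluated at shifted parameters. *)
Lemma stabilization_keller :
  \matrix_(i, j) (f i)^`M(lshift k j) \in unitmx -> keller stabilization.
Proof.
move=> fU; pose v := ord_sum_case (fun j => 'X_(lshift k j)) shifted_var.
pose FZ := map_mx (msubst v) (\matrix_(i, j) (f i)^`M(lshift k j)).
pose FW : 'M_(n, k) := \matrix_(i, s) msubst v (f i)^`M(rshift n s).
pose Q : 'M_(n, k) := \matrix_(i, s) msubst shifted_var (q i)^`M(s).
pose J : 'M_(k, n) := \matrix_(s, j) embl (p s)^`M(j).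
have dWl s j : (shifted_var s)^`M(lshift k j) = J s j.
  by rewrite mderivD mderivXX eq_shift add0r mderiv_embll mxE.
have dWr s u : (shifted_var s)^`M(rshift n u) = (s == u)%:R.
  by rewrite mderivD mderivXX eq_shift mderiv_emblr addr0.
have sW (a : 'I_k -> {mpoly K[n + k]}) u :
    \sum_s a s * (shifted_var s)^`M(rshift n u) = a u.
  rewrite (bigD1 u) //= dWr eqxx mulr1 big1 ?addr0 // => s su.
  by rewrite dWr (negPf su) mulr0.
rewrite /keller (_ : jacobian _ = block_mx 1%:M (FW - Q) 0 1%:M *m block_mx FZ 0 J 1%:M).
  rewrite unitmxE det_mulmx det_ublock det_lblock !det1 !mul1r mulr1 -unitmxE.
  exact: map_mx_unitmx.
rewrite jacobian_block mulmx_block !mulmx0 !mul0mx !mulmx1 !mul1mx !add0r.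
have dv i s : (msubst v (f i))^`M(s)
    = \sum_j msubst v (f i)^`M(lshift k j) * ('X_(lshift k j))^`M(s)
      + \sum_u FW i u * (shifted_var u)^`M(s).
  rewrite mderiv_msubst big_split_ord /=; congr (_ + _); apply: eq_bigr => j _.
    by rewrite /v ord_sum_caseL.
  by rewrite /v ord_sum_caseR mxE.
congr block_mx; apply/matrixP => i j;
  rewrite ?mxE /stabilization ?ord_sum_caseL ?ord_sum_caseR ?dWl ?dWr ?mxE //.
- rewrite mderivB dv mderiv_msubst (bigD1 j) //= mderivXX eqxx mulr1 big1 ?addr0.
    rewrite -addrA -sumrB; congr (_ + _); apply: eq_bigr => u _.
    by rewrite dWl !mxE mulrBl.
  by move=> s sj; rewrite mderivXX eq_shift (negPf sj) mulr0.
- rewrite mderivB dv mderiv_msubst big1 ?add0r => [|s _]; last first.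
    by rewrite mderivXX eq_shift mulr0.
  by rewrite !sW !mxE.
Qed.

(** A right inverse G satisfies [shifted_var](G) = w, hence f(G_z, w) - q(w) = z with G_z its first
    [n] components. Substituting c for w and z - q(c) for z gives f(g, c) = z. *)
Lemma stabilization_right_inverse (c : 'I_k -> K) :
  right_invertible stabilization ->
  exists g : 'I_n -> {mpoly K[n]},
    forall i, msubst (ord_sum_case g (fun s => (c s)%:MP)) (f i) = 'X_i.
Proof.
move=> [G GP]; pose qc i := msubst (fun s => (c s)%:MP : {mpoly K[n]}) (q i).
have GW s : msubst G (shifted_var s) = 'X_(rshift n s).
  by have := GP (rshift n s); rewrite /stabilization ord_sum_caseR.
pose tau := ord_sum_case (fun i => 'X_i - qc i) (fun s => (c s)%:MP : {mpoly K[n]}).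
exists (fun i => msubst tau (G (lshift k i))) => i.
have qE : msubst tau (msubst G (msubst shifted_var (q i))) = qc i.
  rewrite (msubst_comp shifted_var G) (msubst_ext GW) msubst_comp.
  by apply: msubst_ext => s; rewrite msubstX /tau ord_sum_caseR.
have := congr1 (msubst tau) (GP (lshift k i)).
rewrite /stabilization ord_sum_caseL !rmorphB /= qE msubstX.
rewrite [tau (lshift k i)]ord_sum_caseL !msubst_comp.
move=> /addIr <-; apply: msubst_ext => s.
have [j ->|u ->] := split_ordP s.
  by rewrite !ord_sum_caseL msubstX.
by rewrite !ord_sum_caseR -msubst_comp GW msubstX /tau ord_sum_caseR.
Qed.

End Stabilization.
End Embeddings.

Arguments embl {n} k {K} p.

(** * From cubic to cubic homogeneous maps *)

(** A parameter t makes t H_2 cubic, but t^2 H_3 has degree 5. After y -> y - H_3(x), subtracting q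
    = t^2 y cancels t^2 H_3 and leaves t^2 y, so every nonlinear term becomes cubic. *)
Lemma cubic_right_invertible (K : numClosedFieldType) n
    (H2 H3 : 'I_n -> {mpoly K[n]}) :
  homogeneous_cauchy_polynomial K ->
  (forall i, H2 i \is 2.-homog) -> (forall i, H3 i \is 3.-homog) ->
  keller (fun i => 'X_i - H2 i - H3 i) ->
  right_invertible (fun i => 'X_i - H2 i - H3 i).
Proof.
move=> A h2 h3 JU; pose R := {mpoly K[n + (n + 1)]}.
pose x i : R := 'X_(lshift (n + 1) i).
pose y i : R := 'X_(rshift n (lshift 1 i)).
pose t : R := 'X_(rshift n (rshift n ord0)).
pose E : {mpoly K[n]} -> R := embl (n + 1).
pose f i := x i - t * E (H2 i) - t ^+ 2 * E (H3 i).
pose p : 'I_(n + 1) -> {mpoly K[n]} := ord_sum_case (fun i => - H3 i) (fun=> 0).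
pose q (i : 'I_n) : {mpoly K[n + 1]} :=
  'X_(rshift n ord0) ^+ 2 * 'X_(lshift 1 i).
pose Hc : 'I_(n + (n + 1)) -> R :=
  ord_sum_case (fun i => t * E (H2 i) + t ^+ 2 * y i)
    (ord_sum_case (fun i => E (H3 i)) (fun=> 0)).
have Xh m (s : 'I_m) : ('X_s : {mpoly K[m]}) \is 1.-homog.
  by rewrite dhomogX /= mdeg1.
have t1 : t \is 1.-homog by exact: Xh.
have Eh d r : r \is d.-homog -> E r \is d.-homog.
  by apply: msubst_linear_homog => i; exact: Xh.
have Hc3 s : Hc s \is 3.-homog.
  rewrite /Hc; have [i ->|u ->] := split_ordP s.
    rewrite ord_sum_caseL; apply: rpredD.
      exact: (dhomogM t1 (Eh _ _ (h2 i))).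
    exact: (dhomogM (dhomogMn 2 t1) (Xh _ _)).
  rewrite ord_sum_caseR; have [i ->|j ->] := split_ordP u.
    by rewrite ord_sum_caseL; apply: Eh.
  by rewrite ord_sum_caseR rpred0.
have WL i : shifted_var p (lshift 1 i) = y i - E (H3 i).
  by rewrite /shifted_var /p ord_sum_caseL rmorphN.
have WR : shifted_var p (rshift n ord0) = t.
  by rewrite /shifted_var /p ord_sum_caseR rmorph0 addr0.
have stabE : stabilization f p q = fun s => 'X_s - Hc s.
  apply: funext => s; rewrite /stabilization /Hc; have [i ->|u ->] := split_ordP s.
    rewrite !ord_sum_caseL /f !rmorphB !rmorphM ?rmorphXn /= !msubst_embl !msubstX.
    by rewrite ord_sum_caseL ord_sum_caseR WL WR -/(x i) -[msubst _ (H2 i)]/(E _)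
      -[msubst _ (H3 i)]/(E _); ring.
  rewrite !ord_sum_caseR; have [i ->|j ->] := split_ordP u.
    by rewrite WL ord_sum_caseL.
  by rewrite ord1 WR ord_sum_caseR subr0.
(* The derivatives of H_2 and H_3 have degrees 1 and 2, so the Jacobian of f in x is that of z - H_2
   - H_3 evaluated at t x. *)
have fU : \matrix_(i, j) (f i)^`M(lshift (n + 1) j) \in unitmx.
  pose sc : {mpoly K[n]} -> R := msubst (fun i => t * x i).
  rewrite (_ : \matrix_(i, j) _ = map_mx sc (jacobian (fun i => 'X_i - H2 i - H3 i))).
    exact: map_mx_unitmx.
  have dt r j : (t * r)^`M(lshift (n + 1) j) = t * r^`M(lshift (n + 1) j).
    by rewrite mderivM mderivXX eq_shift mul0r add0r.
  apply/matrixP => i j; rewrite !mxE /f expr2 -mulrA !mderivB !dt !mderiv_embll.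
  rewrite !mderivXX eq_shift.
  rewrite /sc !rmorphB rmorph_nat /=.
  rewrite (msubst_homog _ _ (mderiv_homog j (h2 i))).
  by rewrite (msubst_homog _ _ (mderiv_homog j (h3 i))) expr1 expr2 -mulrA.
(* The parameters are specialized to y = 0 and t = 1, where f is the original map. *)
have [|g gE] := @stabilization_right_inverse _ _ _ f p q
    (ord_sum_case (fun=> 0) (fun=> 1)).
  rewrite stabE; apply: cubic_homogeneous_right_invertible => //.
  by have := @stabilization_keller _ _ _ f p q fU; rewrite stabE.
exists g => i; rewrite -[RHS]gE /f !rmorphB !rmorphM ?rmorphXn /= !msubst_embl.
by rewrite !msubstX ord_sum_caseL !ord_sum_caseR mpolyC1 ?expr1n !mul1r.
Qed.

(** * Affine normalization of maps of degree at most 3 *)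

Section LinearChange.
Variables (K : fieldType) (n : nat) (F : 'I_n -> {mpoly K[n]}).
Variables (A : 'M[K]_n) (b : 'I_n -> K).
Hypothesis AU : A \in unitmx.

Definition affine_image i : {mpoly K[n]} := \sum_j A i j *: F j - (b i)%:MP.

Lemma affine_image_keller : keller F -> keller affine_image.
Proof.
rewrite /keller => JU.
rewrite (_ : jacobian affine_image = map_mx (@mpolyC n K) A *m jacobian F).
  by rewrite unitmx_mul JU andbT map_mx_unitmx.
apply/matrixP => i j; rewrite !mxE mderivB mderivC subr0 raddf_sum /=.
by apply: eq_bigr => s _; rewrite !mxE mderivZ mul_mpolyC.
Qed.

(** If G is a right inverse of A F - b, then G(A z - b) is one of F. *)
Lemma affine_image_right_invertible :
  right_invertible affine_image -> right_invertible F.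
Proof.
move=> [G GE].
have GF i : \sum_j A i j *: msubst G (F j) = 'X_i + (b i)%:MP.
  rewrite -(GE i) rmorphB rmorph_sum /= msubstC subrK.
  by apply: eq_bigr => j _; rewrite msubstZ.
pose tau i : {mpoly K[n]} := \sum_j A i j *: 'X_j - (b i)%:MP.
exists (fun i => msubst tau (G i)) => i; rewrite -msubst_comp.
have tF k : \sum_j A k j *: msubst tau (msubst G (F j)) = \sum_j A k j *: 'X_j.
  have := congr1 (msubst tau) (GF k).
  rewrite rmorphD rmorph_sum /= msubstX msubstC subrK => <-.
  by apply: eq_bigr => j _; rewrite msubstZ.
have inv (v : 'I_n -> {mpoly K[n]}) :
    v i = \sum_k invmx A i k *: \sum_j A k j *: v j.
  under eq_bigr => k _ do rewrite scaler_sumr.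
  rewrite exchange_big /= (bigD1 i) //= [X in _ + X]big1 ?addr0 => [|j ji].
    under eq_bigr => k _ do rewrite scalerA.
    rewrite -scaler_suml; have /matrixP /(_ i i) := mulVmx AU.
    by rewrite !mxE eqxx => ->; rewrite scale1r.
  under eq_bigr => k _ do rewrite scalerA.
  rewrite -scaler_suml; have /matrixP /(_ i j) := mulVmx AU.
  by rewrite !mxE eq_sym (negPf ji) => ->; rewrite scale0r.
rewrite [LHS](inv (fun j => msubst tau (msubst G (F j)))) [RHS](inv (fun j => 'X_j)).
by apply: eq_bigr => k _; rewrite tF.
Qed.

End LinearChange.

Lemma mcoeff_pihomog n (K : nzRingType) d (p : {mpoly K[n]}) m :
  (pihomog mdeg d p)@_m = if mdeg m == d then p@_m else 0.
Proof.
pose k := maxn (msize p) (mdeg m).+1.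
rewrite (@pihomogwE _ _ _ _ k) ?leq_maxl // big_mkcond /=.
rewrite (eq_bigr (fun l : 'X_{1..n < k} =>
  (if mdeg l == d then p@_l else 0) *: 'X_[l])) => [|l _].
  by rewrite (mcoeff_mpoly (fun l => if mdeg l == d then p@_l else 0)) // leq_maxr.
by case: ifP => // _; rewrite scale0r.
Qed.

(** [msize] exceeds the degree by one, so the degree is at most 3. Multiplying F by the inverse of
    its linear part at 0 and removing the constant term gives z - H_2 - H_3. *)
Lemma cubic_degree_right_invertible (K : numClosedFieldType) n
    (F : 'I_n -> {mpoly K[n]}) :
  homogeneous_cauchy_polynomial K -> (forall i, (msize (F i) <= 4)%N) ->
  keller F -> right_invertible F.
Proof.
move=> A F4 JU; pose L := map_mx (mcoeff 0%MM) (jacobian F).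
have LU : L \in unitmx by exact: map_mx_unitmx.
have LE i j : L i j = (F i)@_U_(j).
  by rewrite !mxE mcoeff_deriv mnm0E add0m.
pose A' := invmx L.
have A'U : A' \in unitmx by rewrite unitmx_inv.
pose b i := (\sum_j A' i j *: F j)@_0%MM.
apply: (@affine_image_right_invertible _ _ F _ b A'U).
have := @affine_image_keller _ _ F _ b A'U JU.
pose H d i := - pihomog mdeg d (affine_image F A' b i).
suff -> : affine_image F A' b = fun i => 'X_i - H 2 i - H 3 i.
  by apply: cubic_right_invertible => // i; rewrite rpredN; apply: pihomogP.
apply: funext => i; apply/mpolyP => m; rewrite /H.
have FE : (affine_image F A' b i)@_m
    = \sum_j A' i j * (F j)@_m - b i * (m == 0%MM)%:R.
  rewrite mcoeffB mcoeffC raddf_sum /=; congr (_ - _).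
  by apply: eq_bigr => j _; rewrite mcoeffZ.
move: (affine_image F A' b i) FE => a FE.
rewrite !opprK !mcoeffD mcoeffX !mcoeff_pihomog.
have [m4|m4] := ltnP (mdeg m) 4; last first.
  rewrite !(gtn_eqF (leq_trans _ m4)) // !addr0 FE big1 => [|j _].
    case: eqP => [m0|_]; first by rewrite m0 mdeg0 in m4.
    case: eqP => [m1|_]; first by rewrite -m1 mdeg1 in m4.
    by rewrite mulr0 subr0.
  rewrite (_ : (F j)@_m = 0) ?mulr0 //; apply/eqP.
  by rewrite mcoeff_eq0 msize_mdeg_ge // (leq_trans (F4 j)).
case md : (mdeg m) m4 => [|[|[|[|]]]] //= _; rewrite ?add0r ?addr0.
- have m0 : m = 0%MM by apply/eqP; rewrite -mdeg_eq0 md.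
  rewrite FE m0 mnm1_eq0 eqxx mulr1 /b raddf_sum /=; apply/eqP; rewrite subr_eq0.
  by apply/eqP/eq_bigr => j _; rewrite mcoeffZ.
- have /mdeg1P[j /eqP mE] : mdeg m == 1%N by rewrite md.
  rewrite FE mE mnm1_eq0 mulr0 subr0.
  have /matrixP /(_ i j) := mulVmx LU; rewrite mxE [RHS]mxE => E.
  rewrite -mcoeffX mcoeffXU -E.
  by apply: eq_bigr => k _; rewrite LE.
- by case: eqP => [m1|]; [rewrite -m1 mdeg1 in md|rewrite add0r].
- by case: eqP => [m1|]; [rewrite -m1 mdeg1 in md|rewrite add0r].
Qed.

(** * Lowering the degree to 3 *)

Section DegreeBounds.
Variable K : fieldType.

Definition deg_le n d (p : {mpoly K[n]}) : Prop := (msize p <= d.+1)%N.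

Lemma deg_le_trans n d e (p : {mpoly K[n]}) : (d <= e)%N -> deg_le d p -> deg_le e p.
Proof. by move=> de pd; apply: leq_trans pd _. Qed.

Lemma deg_leD n d (p q : {mpoly K[n]}) : deg_le d p -> deg_le d q -> deg_le d (p + q).
Proof. by move=> pd qd; apply: leq_trans (msizeD_le _ _) _; rewrite geq_max pd. Qed.

Lemma deg_leZ n d c (p : {mpoly K[n]}) : deg_le d p -> deg_le d (c *: p).
Proof. by apply: leq_trans; apply: msizeZ_le. Qed.

Lemma deg_le_sum n d (I : Type) (r : seq I) (P : pred I) (f : I -> {mpoly K[n]}) :
  (forall i, P i -> deg_le d (f i)) -> deg_le d (\sum_(i <- r | P i) f i).
Proof.
move=> fd; elim/big_ind: _ => [|p q|//]; last exact: deg_leD.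
by rewrite /deg_le msize0.
Qed.

Lemma deg_leM n d e (p q : {mpoly K[n]}) :
  deg_le d p -> deg_le e q -> deg_le (d + e) (p * q).
Proof.
rewrite /deg_le => pd qe.
have [->|p0] := eqVneq p 0; first by rewrite mul0r msize0.
have [->|q0] := eqVneq q 0; first by rewrite mulr0 msize0.
by rewrite msizeM //; move: (msize p) (msize q) pd qe => a b; lia.
Qed.

Lemma deg_leX n (m : 'X_{1..n}) : deg_le (mdeg m) ('X_[m] : {mpoly K[n]}).
Proof. by rewrite /deg_le msizeX. Qed.

Lemma deg_le_embl n k d (p : {mpoly K[n]}) : deg_le d p -> deg_le d (embl k p).
Proof.
move=> pd; rewrite (mpolyE p) rmorph_sum big_seq; apply: deg_le_sum => m mp.
rewrite /= /embl msubstZ; apply: deg_leZ; apply: (@deg_le_trans _ (mdeg m)).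
  by rewrite -ltnS (leq_trans (msize_mdeg_lt mp)).
rewrite /msubst mmapX /mmap1 mdegE.
elim/big_ind2: _ => [|q i r j|i _]; [by rewrite /deg_le msize1|exact: deg_leM|].
elim: (m i) => [|e IH]; first by rewrite /deg_le expr0 msize1.
rewrite exprS -add1n; apply: deg_leM => //.
by rewrite /deg_le msizeX mdeg1.
Qed.

End DegreeBounds.

Lemma mnm_split n (m : 'X_{1..n}) e :
  (e <= mdeg m)%N -> exists a b, m = (a + b)%MM /\ mdeg a = e.
Proof.
elim: e => [_|e IH em]; first by exists 0%MM, m; rewrite add0m mdeg0.
have [a [b [mE ae]]] := IH (ltnW em).
have [i bi] : exists i, b i != 0%N.
  apply/existsP; apply: contraLR em => /existsPn b0.
  have -> : m = a.
    rewrite mE; apply/mnmP => i; rewrite mnmDE.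
    by have := b0 i; rewrite negbK => /eqP ->; rewrite addn0.
  by rewrite ae ltnn.
exists (a + U_(i))%MM, (b - U_(i))%MM; split; last by rewrite mdegD mdeg1 ae addn1.
by rewrite -addmA [(U_(i) + _)%MM]addmC submK ?lep1mP.
Qed.

(** Each monomial of degree [d] is factored as P Q with degrees 2 and d - 2 and receives its own
    pair of variables u, v. Stabilization replaces P Q by P Q - (u + P)(v + Q) = -(u v + u Q + P v),
    for all monomials at once. *)
Lemma degree_reduction (K : fieldType) d :
  (4 <= d)%N ->
  (forall n (F : 'I_n -> {mpoly K[n]}),
     (forall i, deg_le d.-1 (F i)) -> keller F -> right_invertible F) ->
  forall n (F : 'I_n -> {mpoly K[n]}),
    (forall i, deg_le d (F i)) -> keller F -> right_invertible F.
Proof.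
move=> d4 IH n F Fd JU.
pose T : finType := 'X_{1..n < d.+1}.
pose N := #|T|.
pose en (s : 'I_N) : T := enum_val s.
(* Indices run over all monomials of degree at most [d]; below [d] the factors are 1 and the
   coefficient [top] is 0. *)
pose split_of (m : T) (ab : 'X_{1..n} * 'X_{1..n}) :=
  if mdeg m == d then [/\ bmnm m = (ab.1 + ab.2)%MM, mdeg ab.1 = 2%N
                        & mdeg ab.2 = (d - 2)%N]
  else ab = (0%MM, 0%MM).
have [ab abP] : exists ab : T -> 'X_{1..n} * 'X_{1..n}, forall m, split_of m (ab m).
  apply: (@fin_all_exists T (fun=> ('X_{1..n} * 'X_{1..n})%type) split_of) => m.
  rewrite /split_of; case: eqP => [md|_]; last by exists (0, 0)%MM.
  have [|a [b [mE a2]]] := @mnm_split n m 2; first by rewrite md; lia.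
  exists (a, b); split=> //=; have := md; rewrite mE mdegD a2; lia.
pose top i (m : T) := if mdeg m == d then (F i)@_m else 0.
pose P s : {mpoly K[n]} := 'X_[(ab (en s)).1].
pose Q s : {mpoly K[n]} := 'X_[(ab (en s)).2].
pose c i (s : 'I_N) := top i (en s).
pose L i := F i - \sum_s c i s *: (P s * Q s).
have abd (m : T) : (mdeg (ab m).1 <= 2)%N /\ (mdeg (ab m).2 <= d - 2)%N.
  by have := abP m; rewrite /split_of; case: ifP => [_ [_ -> ->]|_ ->]; rewrite ?mdeg0.
have Pd s : deg_le 2 (P s).
  by apply: deg_le_trans (deg_leX _ _); have [] := abd (en s).
have Qd s : deg_le (d - 2) (Q s).
  by apply: deg_le_trans (deg_leX _ _); have [] := abd (en s).
have Ld i : deg_le d.-1 (L i).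
  have -> : L i = \sum_(m : T) ((F i)@_m - top i m) *: 'X_[m].
    rewrite /L [in LHS](mpolywE (Fd i)).
    rewrite -(big_enum_val (A := T) (fun m => top i m *: ('X_[(ab m).1] * 'X_[(ab m).2]))).
    rewrite -sumrB; apply: eq_bigr => m _.
    rewrite scalerBl; congr (_ - _); rewrite /top.
    by have := abP m; rewrite /split_of; case: ifP => [_ [{3}-> _ _]|]; rewrite ?mpolyXD ?scale0r.
  apply: deg_le_sum => m _; rewrite /top; case: eqP => [_|/eqP md].
    by rewrite subrr scale0r /deg_le msize0.
  apply: deg_leZ; apply: deg_le_trans (deg_leX _ _).
  by have := bmdeg m; lia.
pose f i := embl (N + N) (F i).
pose p : 'I_(N + N) -> {mpoly K[n]} := ord_sum_case P Q.
pose q i : {mpoly K[N + N]} :=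
  \sum_s c i s *: ('X_(lshift N s) * 'X_(rshift N s)).
pose E : {mpoly K[n]} -> {mpoly K[n + (N + N)]} := embl (N + N).
pose u s : {mpoly K[n + (N + N)]} := 'X_(rshift n (lshift N s)).
pose v s : {mpoly K[n + (N + N)]} := 'X_(rshift n (rshift N s)).
have fU : \matrix_(i, j) (f i)^`M(lshift (N + N) j) \in unitmx.
  rewrite (_ : \matrix_(i, j) _ = map_mx E (jacobian F)); first exact: map_mx_unitmx.
  by apply/matrixP => i j; rewrite !mxE mderiv_embll.
have Xd m (s : 'I_m) : deg_le 1 ('X_s : {mpoly K[m]}).
  by rewrite /deg_le msizeX mdeg1.
have WL s : shifted_var p (lshift N s) = u s + E (P s).
  by rewrite /shifted_var /p ord_sum_caseL.
have WR s : shifted_var p (rshift N s) = v s + E (Q s).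
  by rewrite /shifted_var /p ord_sum_caseR.
have Wd s : deg_le d.-1 (shifted_var p s).
  have [j ->|j ->] := split_ordP s; rewrite ?WL ?WR; apply: deg_leD.
  - by apply: deg_le_trans (Xd _ _); lia.
  - by apply: deg_le_embl; apply: deg_le_trans (Pd _); lia.
  - by apply: deg_le_trans (Xd _ _); lia.
  - by apply: deg_le_embl; apply: deg_le_trans (Qd _); lia.
have stabd s : deg_le d.-1 (stabilization f p q s).
  rewrite /stabilization; have [i ->|j ->] := split_ordP s; last by rewrite ord_sum_caseR.
  rewrite ord_sum_caseL /f msubst_embl -[msubst _ (F i)]/(E (F i)).
  have -> : F i = L i + \sum_s c i s *: (P s * Q s) by rewrite subrK.
  have -> : E (L i + \sum_s c i s *: (P s * Q s)) - msubst (shifted_var p) (q i)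
      = E (L i) + \sum_s (- c i s) *: (u s * v s + (u s * E (Q s) + E (P s) * v s)).
    rewrite /E rmorphD -addrA; congr (_ + _); rewrite !rmorph_sum -sumrB.
    apply: eq_bigr => r _ /=; rewrite [embl _ (_ *: _)]msubstZ msubstZ -scalerBr.
    rewrite scaleNr -scalerN; congr (_ *: _).
    rewrite -[msubst _ (P r * Q r)]/(embl (N + N) _) !rmorphM /= !msubstX WL WR /E.
    ring.
  apply: deg_leD; first exact: deg_le_embl.
  (* The degrees are 2, d - 1 and 3, all at most d - 1 because d >= 4. *)
  apply: deg_le_sum => r _; apply: deg_leZ; apply: deg_leD; last apply: deg_leD.
  - by apply: deg_le_trans (deg_leM (Xd _ _) (Xd _ _)); lia.
  - apply: deg_le_trans (deg_leM (Xd _ _) (deg_le_embl _ (Qd _))); lia.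
  - apply: deg_le_trans (deg_leM (deg_le_embl _ (Pd _)) (Xd _ _)); lia.
have [|g gE] := @stabilization_right_inverse _ _ _ f p q (fun=> 0).
  by apply: IH => //; apply: stabilization_keller.
by exists g => i; rewrite -[RHS]gE /f msubst_embl.
Qed.

(** * Conclusion *)

(** Induction on a common degree bound: up to 3 the cubic case applies, and from 4 on the bound
    drops by one. *)
Lemma keller_right_invertible (K : numClosedFieldType) n (F : 'I_n -> {mpoly K[n]}) :
  homogeneous_cauchy_polynomial K -> keller F -> right_invertible F.
Proof.
move=> A; have H d : forall n (F : 'I_n -> {mpoly K[n]}),
    (forall i, deg_le d (F i)) -> keller F -> right_invertible F.
  elim: d => [|d IH] m G Gd.
    by apply: cubic_degree_right_invertible => // i; apply: leq_trans (Gd i) _.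
  have [d4|d4] := leqP 4 d.+1; first exact: (@degree_reduction K d.+1).
  by apply: cubic_degree_right_invertible => // i; apply: leq_trans (Gd i) _.
apply: (H (\max_i msize (F i))) => i; apply: leqW.
exact: (leq_bigmax (F := fun i => msize (F i))).
Qed.

Lemma cauchy_jacobian_conjecture (K : numClosedFieldType) :
  homogeneous_cauchy_polynomial K -> jacobian_conjecture K.
Proof.
move=> A n H _ H0 F dF.
have [|G FG] := @keller_right_invertible K n F A.
  by rewrite /keller unitmxE dF unitr1.
have GF := right_inverse_left FG.
exists (fun i => series_of_mpoly (G i)); split; last by move=> i; exists (G i).
apply: formal_inverse_unique => // i.
by rewrite /F mcoeffB H0 subr0 mcoeffX mnm1_eq0.
Qed.

Theorem proposition4p2 (R : realType) :
  (forall (n : nat) (P : {mpoly R[i][n]}),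
     (1 <= n)%N -> P \is 4.-homog -> nilpotent_mx (hessian P) ->
     exists U : mseries n.+1 R[i],
       unique (cauchy_solution P) U /\ is_polynomial U)
  <->
  (forall (n : nat) (H : 'I_n -> {mpoly R[i][n]}),
     (1 <= n)%N -> (forall i, (H i)@_0%MM = 0) ->
     let F := fun i : 'I_n => 'X_i - H i in
     \det (jacobian F) = 1 ->
     exists G : 'I_n -> mseries n R[i],
       unique (is_formal_inverse F) G /\ forall i, is_polynomial (G i)).
Proof.
split; first exact: (@cauchy_jacobian_conjecture R[i]).
exact: (@jacobian_conjecture_cauchy R[i]).
Qed.
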